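(* Consider the finite interval graph $A_n$ with metric $g=\sum_{i=1}^{n-1}h_i(\phi_i a_i\otimes a_i'+\epsilon a_i'\otimes a_i)$ defined by $h_i\ne0$, $\epsilon=\pm1$ and $\phi_i\neq0$. (1) There is a quantum Riemannian geometry of the form $$\phi_{i+1}=\phi_1-\frac1{\phi_i},\qquad \tau_{i+1}=-1+\frac{\phi_{i+1}}{\phi_i+\epsilon\tau_i},\qquad \tau_i'=\epsilon\frac{\phi_i-\phi_{i+1}}{\tau_i},$$ $$\sigma_i=\frac{h_{i+1}\phi_{i+1}}{h_i\phi_i(1+\tau_i')},\qquad \sigma_i'=\frac{h_{i-1}(\phi_{i-1}+\epsilon\tau_{i-1})}{h_i\phi_i}$$ for arbitrary $\tau_1\ne0$ (the connection being, for $h_i,\phi_1$ real, $*$-preserving if and only if $|\tau_1|=1$), provided $\phi_1$ is such that the iteration for $\phi_i$ leads to $\phi_n=0$ and all preceding $\phi_i\ne0$. In this case $$\phi_{n-i}=\frac1{\phi_i}.$$ (2) The physical choice where $\phi_i>0$ for $i=1,\dots,n-1$ is provided by $\phi_1=2\cos\big(\frac{\pi}{n+1}\big)$ and results in $$\phi_i=\frac{\sin\big(\frac{(i+1)\pi}{n+1}\big)}{\sin\big(\frac{i\pi}{n+1}\big)}=\frac{(i+1)_q}{(i)_q},\qquad q=e^{\imath\pi/(n+1)} .$$ (3) For this choice, if $\tau_1=s=\pm1$ and $\epsilon=1$, then $$\tau_i=\frac{s(-1)^{i-1}}{(i)_q},\qquad q=e^{\imath\pi/(n+1)},$$ with $\tau_i',\sigma_i,\sigma_i'$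 given in terms of this by $$\tau_i'=-\tau_{i+1},\qquad \sigma_i=\frac{h_{i+1}}{h_i}(1+\tau_{i+1}),\qquad \sigma_i'=\frac{h_{i-1}}{h_i}\frac{1}{1+\tau_i},$$ where $\tau_n$ (needed for $\tau_{n-1}'$) is given by the same formula for $\tau_i$. This is a $q$-deformation of the solution $\phi_i=\frac{i+1}{i}$, $\tau_i=\frac{s(-1)^{i-1}}{i}$ (with the same formulae for $\tau_i',\sigma_i,\sigma_i'$) on the half-line graph $\mathbb{N}$, and is called the canonical quantum Riemannian geometry of $A_n$.
   Context: $(i)_q=\frac{q^i-q^{-i}}{q-q^{-1}}$. A quantum Riemannian geometry here means a metric $g$ together with a quantum Levi-Civita connection for it. **Calculus.** $A_n$ is the graph with vertices $1,\dots,n$ and edges $i-(i+1)$, $1\le i\le n-1$ ($n\ge 2$). $A=\mathbb{C}(\{1,\dots,n\})$ is the algebra of complex functions on vertices. $\Omega^1$ has basis over $\mathbb{C}$ the arrows $a_i=\omega_{i\to i+1}$, $a_i'=\omega_{i+1\to i}$, $1\le i\le n-1$. It is an $A$-bimodule via $f a_i=f(i)a_i$, $a_i f=f(i+1)a_i$, $f a_i'=f(i+1)a_i'$, $a_i'f=f(i)a_i'$, with $\mathrm{d}f=\sum_i (f(i+1)-f(i))(a_i-a_i')$. $\Omega^1\otimes_A\Omega^1$ has basis the 2-step paths $a_i\otimes a_{i+1}$, $a_{i+1}'\otimes a_i'$, $a_i\otimes a_i'$, $a_i'\otimes a_i$ ($\otimes$ means $\otimes_A$). $\Omega^2$ is the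 quotient of $\Omega^1\otimes_A\Omega^1$ (quotient map $\wedge$) by $a_i\wedge a_{i+1}=0$, $a_{i+1}'\wedge a_i'=0$, $a_{i+1}\wedge a_{i+1}'+a_i'\wedge a_i=0$ ($1\le i\le n-2$), $a_1\wedge a_1'=0$, $a_{n-1}'\wedge a_{n-1}=0$. With $\theta=\sum_i(a_i+a_i')$, $\mathrm{d}:\Omega^1\to\Omega^2$ is $\mathrm{d}\omega=\theta\wedge\omega+\omega\wedge\theta$. **Connections.** A bimodule connection on $\Omega^1$ is a linear map $\nabla:\Omega^1\to\Omega^1\otimes_A\Omega^1$ together with a bimodule map $\sigma:\Omega^1\otimes_A\Omega^1\to\Omega^1\otimes_A\Omega^1$ such that $\nabla(f\omega)=\mathrm{d}f\otimes\omega+f\nabla\omega$ and $\nabla(\omega f)=(\nabla\omega)f+\sigma(\omega\otimes\mathrm{d}f)$. It extends to tensor products by $\nabla(\omega\otimes\eta)=\nabla\omega\otimes\eta+(\sigma(\omega\otimes(\ ))\otimes\mathrm{id})\nabla\eta$. It is a quantum Levi-Civita connection (QLC) for $g$ if $\wedge\nabla=\mathrm{d}$ on $\Omega^1$ and $\nabla g=0$. **Connection coefficients.** The connection with coefficients $\tau_i,\tau_i'$ ($1\le i\le n-1$), $\sigma_i$ ($1\le i\le n-2$), $\sigma_i'$ ($2\le i\le n-1$) is $\nabla\omega=\theta\otimes\omega-\sigma(\omega\otimes\theta)$ with $\sigma(a_i\otimes a_{i+1})=\sigma_i\,a_i\otimes a_{i+1}$; $\sigma(a_i'\otimes a_{i-1}')=\sigma_i'\,a_i'\otimes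 a_{i-1}'$; $\sigma(a_1\otimes a_1')=\tau_1\,a_1\otimes a_1'$; $\sigma(a_i\otimes a_i')=\tau_i\,a_i\otimes a_i'+(1+\tau_i)\,a_{i-1}'\otimes a_{i-1}$ ($2\le i\le n-1$); $\sigma(a_i'\otimes a_i)=\tau_i'\,a_i'\otimes a_i+(1+\tau_i')\,a_{i+1}\otimes a_{i+1}'$ ($1\le i\le n-2$); $\sigma(a_{n-1}'\otimes a_{n-1})=\tau_{n-1}'\,a_{n-1}'\otimes a_{n-1}$. The formulae in the claim are for indices in these ranges. **$*$-structure.** $f^*=\bar f$, $a_i^*=-a_i'$, $a_i'^*=-a_i$ extended antilinearly; $(\omega\otimes\eta)^\dagger=\eta^*\otimes\omega^*$. $\nabla$ is $*$-preserving if $\nabla\circ *=\sigma\circ\dagger\circ\nabla$.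
   Formalization: In (1), ''arbitrary τ_1≠0'' is restricted to those τ_1 for which the denominators τ_i, φ_i+ετ_i and 1+τ_i' in the displayed formulas do not vanish (for n=3, φ_1=√2, τ_1=-εφ_1 the formula for τ_2 is undefined); for φ_1 real and |τ_1|=1 this is proved to hold. *)

(* Defs.v *)
From mathcomp Require Import all_boot all_order all_algebra.
From mathcomp Require Import mathcomp_extra boolp classical_sets functions.
From mathcomp Require Import reals topology normedtype trigo.
From mathcomp.real_closed Require Import complex.

Set Implicit Arguments.
Unset Strict Implicit.
Unset Printing Implicit Defensive.

Import Order.TTheory GRing.Theory Num.Theory.
Local Open Scope ring_scope.

(* Quantum Riemannian geometry of the interval graph A_n (vertices 1, ..., n),
   encoded by [Some n], and of the half-line graph (vertices 1, 2, 3, ...),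
   encoded by [None].

   An element of Omega^1, Omega^1 (x)_A Omega^1, ... is the family of its
   coefficients on the arrows, 2-step paths, ...  For A_n this is the free
   vector space on those (finitely many) paths; on the half-line it also contains
   the infinite formal sums, such as theta and g.

   A path is the list of the vertices it visits: a_i = (i, i+1) and
   a_i' = (i+1, i), and a_i (x) a_{i+1} = (i, i+1, i+2). *)

Section Calculus.
Variables (C : numClosedFieldType) (N : option nat).

Definition is_vertex (i : nat) : bool :=
  (0 < i)%N && (if N is Some n then (i <= n)%N else true).
Definition adj (x y : nat) : bool :=
  [&& is_vertex x, is_vertex y & (y == x.+1) || (x == y.+1)].

Definition is_arrow (p : nat * nat) : bool := adj p.1 p.2.
Definition is_path2 (p : nat * nat * nat) : bool :=
  adj p.1.1 p.1.2 && adj p.1.2 p.2.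
Definition is_path3 (p : nat * nat * nat * nat) : bool :=
  is_path2 p.1 && adj p.1.2 p.2.

Definition Alg := {i | is_vertex i} -> C^o.
Definition Omega1 := {p | is_arrow p} -> C^o.
Definition Tens2 := {p | is_path2 p} -> C^o.
Definition Tens3 := {p | is_path3 p} -> C^o.

(* The coefficient at p, taken to be 0 when p is not a path of the graph. *)
Definition coef (T : Type) (P : pred T) (F : {x | P x} -> C^o) (p : T) : C :=
  if insub p is Some x then F x else 0.

Definition restr (T : Type) (P : pred T) (F : T -> C) : {x | P x} -> C^o :=
  fun x => F (val x).

(* Locally finite sums over i = 0, 1, 2, ...  In every use below the i-th term
   vanishes on the paths whose vertices add up to at most i, so that the bound
   drops no nonzero term. *)
Definition sum1 (F : nat -> Omega1) : Omega1 :=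
  fun p => let '(x, y) := val p in \sum_(0 <= i < x + y) F i p.
Definition sum2 (F : nat -> Tens2) : Tens2 :=
  fun p => let '(x, y, z) := val p in \sum_(0 <= i < x + y + z) F i p.
Definition sum3 (F : nat -> Tens3) : Tens3 :=
  fun p => let '(x, y, z, w) := val p in \sum_(0 <= i < x + y + z + w) F i p.

(* The arrow x -> y, or 0 if it is not in the graph.  In particular
   a_0 = a_0' = 0 and, for A_n, a_n = a_n' = 0: this is what makes the general
   formulas below specialize correctly at the ends of the graph. *)
Definition arrow (x y : nat) : Omega1 :=
  restr (fun p => (p == (x, y))%:R).
Definition a_ (i : nat) : Omega1 := arrow i i.+1.
Definition a'_ (i : nat) : Omega1 := arrow i.+1 i.

Definition tens (w e : Omega1) : Tens2 :=
  restr (fun '(x, y, z) => coef w (x, y) * coef e (y, z)).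
Definition tens21 (T : Tens2) (w : Omega1) : Tens3 :=
  restr (fun '(x, y, z, t) => coef T (x, y, z) * coef w (z, t)).
Local Notation "w ⊗ e" := (tens w e) (at level 40, left associativity).

Definition lact1 (f : Alg) (w : Omega1) : Omega1 :=
  restr (fun '(x, y) => coef f x * coef w (x, y)).
Definition ract1 (w : Omega1) (f : Alg) : Omega1 :=
  restr (fun '(x, y) => coef w (x, y) * coef f y).
Definition lact2 (f : Alg) (T : Tens2) : Tens2 :=
  restr (fun '(x, y, z) => coef f x * coef T (x, y, z)).
Definition ract2 (T : Tens2) (f : Alg) : Tens2 :=
  restr (fun '(x, y, z) => coef T (x, y, z) * coef f z).

Definition d0 (f : Alg) : Omega1 :=
  sum1 (fun i => (coef f i.+1 - coef f i) *: (a_ i - a'_ i)).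
Definition theta : Omega1 := sum1 (fun i => a_ i + a'_ i).

(* The relations of Omega^2.  The third family contains a_1 (x) a_1'
   (i = 0, since a_0 = a_0' = 0) and, for A_n, a_{n-1}' (x) a_{n-1}
   (i = n-1, since a_n = a_n' = 0). *)
Definition rel2 (T : Tens2) : Prop :=
  exists u v w : nat -> C,
    T = sum2 (fun i => u i *: (a_ i ⊗ a_ i.+1)
                     + v i *: (a'_ i.+1 ⊗ a'_ i)
                     + w i *: (a_ i.+1 ⊗ a'_ i.+1 + a'_ i ⊗ a_ i)).

(* wedge_eq S T : the classes of S and T in Omega^2 are equal. *)
Definition wedge_eq (S T : Tens2) : Prop := rel2 (S - T).

Definition bimodule_map (s : Tens2 -> Tens2) : Prop :=
  [/\ linear s,
      forall f T, s (lact2 f T) = lact2 f (s T)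
    & forall T f, s (ract2 T f) = ract2 (s T) f].

Definition bimodule_connection (nab : Omega1 -> Tens2) (s : Tens2 -> Tens2) :
    Prop :=
  [/\ linear nab, bimodule_map s,
      forall f w, nab (lact1 f w) = d0 f ⊗ w + lact2 f (nab w)
    & forall w f, nab (ract1 w f) = ract2 (nab w) f + s (w ⊗ d0 f)].

(* T is the sum of the slice_r T z t (x) (z -> t) over the arrows z -> t, and of
   the (x -> y) (x) slice_l T x y over the arrows x -> y. *)
Definition slice_r (T : Tens2) (z t : nat) : Omega1 :=
  restr (fun '(x, y) => if y == z then coef T (x, z, t) else 0).
Definition slice_l (T : Tens2) (x y : nat) : Omega1 :=
  restr (fun '(z, t) => if z == y then coef T (x, y, t) else 0).

(* (s (w (x) -) (x) id) T *)
Definition sigma_id (s : Tens2 -> Tens2) (w : Omega1) (T : Tens2) : Tens3 :=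
  restr (fun '(x, y, z, t) => coef (s (w ⊗ slice_r T z t)) (x, y, z)).

Definition nabla_tens (nab : Omega1 -> Tens2) (s : Tens2 -> Tens2)
    (w e : Omega1) : Tens3 :=
  tens21 (nab w) e + sigma_id s w (nab e).

(* The extension of nabla_tens by linearity from the basis of 2-step paths. *)
Definition nabla2 (nab : Omega1 -> Tens2) (s : Tens2 -> Tens2) (T : Tens2) :
    Tens3 :=
  sum3 (fun i =>
      coef T (i, i.+1, i.+2) *: nabla_tens nab s (a_ i) (a_ i.+1)
    + coef T (i.+2, i.+1, i) *: nabla_tens nab s (a'_ i.+1) (a'_ i)
    + coef T (i, i.+1, i) *: nabla_tens nab s (a_ i) (a'_ i)
    + coef T (i.+1, i, i.+1) *: nabla_tens nab s (a'_ i) (a_ i)).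

(* g = g1 (x) g2 is a metric if there is a bimodule map (,) with
   (w, g1) g2 = w = g1 (g2, w); ip T stands for the value of (,) on T. *)
Definition is_metric (g : Tens2) : Prop :=
  exists ip : Tens2 -> Alg,
    [/\ linear ip,
        (forall f T i, coef (ip (lact2 f T)) i = coef f i * coef (ip T) i),
        (forall T f i, coef (ip (ract2 T f)) i = coef (ip T) i * coef f i)
      & forall w : Omega1,
          restr (fun '(x, y) => coef (ip (w ⊗ slice_r g x y)) x) = w /\
          restr (fun '(x, y) => coef (ip (slice_l g x y ⊗ w)) y) = w].

(* The second condition is wedge o nab = d, with
   d w = theta /\ w + w /\ theta in Omega^2. *)
Definition is_QLC (g : Tens2) (nab : Omega1 -> Tens2) (s : Tens2 -> Tens2) :
    Prop :=
  [/\ bimodule_connection nab s,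
      forall w, wedge_eq (nab w) (theta ⊗ w + w ⊗ theta)
    & nabla2 nab s g = 0].

Definition star (w : Omega1) : Omega1 :=
  restr (fun '(x, y) => - (coef w (y, x))^* ).
Definition dagger (T : Tens2) : Tens2 :=
  restr (fun '(x, y, z) => (coef T (z, y, x))^* ).

Definition star_preserving (nab : Omega1 -> Tens2) (s : Tens2 -> Tens2) : Prop :=
  forall w, nab (star w) = s (dagger (nab w)).

Definition metric (h phi : nat -> C) (eps : C) : Tens2 :=
  sum2 (fun i => h i *: (phi i *: (a_ i ⊗ a'_ i) + eps *: (a'_ i ⊗ a_ i))).

Definition metric_QLC (g : Tens2) (nab : Omega1 -> Tens2) (s : Tens2 -> Tens2) :
    Prop := is_metric g /\ is_QLC g nab s.

(* The coefficients tau_i, tau_i', sigma_i, sigma_i' of a connection, indexed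
   from 1; the values outside their ranges of indices are irrelevant. *)
Record coeffs := Coeffs {
  c_tau : nat -> C;
  c_tau' : nat -> C;
  c_sig : nat -> C;
  c_sig' : nat -> C
}.

(* The values prescribed on the basis of 2-step paths, extended by linearity.
   For i = 1, and for i = n-1 on A_n, the terms that leave the graph are 0. *)
Definition sigma (c : coeffs) (T : Tens2) : Tens2 :=
  sum2 (fun i =>
      coef T (i, i.+1, i.+2) *: (c_sig c i *: (a_ i ⊗ a_ i.+1))
    + coef T (i.+1, i, i.-1) *: (c_sig' c i *: (a'_ i ⊗ a'_ i.-1))
    + coef T (i, i.+1, i) *: (c_tau c i *: (a_ i ⊗ a'_ i)
                              + (1 + c_tau c i) *: (a'_ i.-1 ⊗ a_ i.-1))
    + coef T (i.+1, i, i.+1) *: (c_tau' c i *: (a'_ i ⊗ a_ i)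
                                 + (1 + c_tau' c i) *: (a_ i.+1 ⊗ a'_ i.+1))).

Definition nabla (c : coeffs) (w : Omega1) : Tens2 :=
  theta ⊗ w - sigma c (w ⊗ theta).

End Calculus.

Arguments metric {C} N h phi eps.
Arguments sigma {C} N c T.
Arguments nabla {C} N c w.

Section Solutions.
Variable C : numClosedFieldType.
Implicit Types (h t : nat -> C) (eps s q : C).

Fixpoint phi (phi1 : C) (i : nat) : C :=
  match i with
  | 0 => 0
  | j.+1 => if j is 0 then phi1 else phi1 - (phi phi1 j)^-1
  end.

Definition admissible (n : nat) (phi1 : C) : Prop :=
  phi phi1 n = 0 /\ forall i, (1 <= i < n)%N -> phi phi1 i != 0.

Fixpoint tau eps (phi1 tau1 : C) (i : nat) : C :=
  match i with
  | 0 => 0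
  | j.+1 => if j is 0 then tau1
            else -1 + phi phi1 j.+1 / (phi phi1 j + eps * tau eps phi1 tau1 j)
  end.

Definition solution h eps (phi1 tau1 : C) : coeffs C :=
  let p := phi phi1 in
  let t := tau eps phi1 tau1 in
  let t' i := eps * (p i - p i.+1) / t i in
  Coeffs t t'
    (fun i => (h i.+1 * p i.+1) / (h i * p i * (1 + t' i)))
    (fun i => (h i.-1 * (p i.-1 + eps * t i.-1)) / (h i * p i)).

(* The denominators of [solution] that are not already nonzero by the hypotheses
   on h and phi do not vanish, for the indices that occur on A_n. *)
Definition solution_defined (n : nat) eps (phi1 tau1 : C) : Prop :=
  let p := phi phi1 in
  let t := tau eps phi1 tau1 in
  [/\ forall i, (1 <= i < n)%N -> t i != 0,
      forall i, (1 <= i)%N -> (i.+1 < n)%N -> p i + eps * t i != 0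
    & forall i, (1 <= i)%N -> (i.+1 < n)%N ->
        1 + eps * (p i - p i.+1) / t i != 0].

(* The connection coefficients given in terms of tau alone. *)
Definition coeffs_of_tau h t : coeffs C :=
  Coeffs t (fun i => - t i.+1)
    (fun i => h i.+1 / h i * (1 + t i.+1))
    (fun i => h i.-1 / h i * (1 + t i)^-1).

(* (i)_q *)
Definition qint q (i : nat) : C := (q ^+ i - q ^- i) / (q - q^-1).

Definition tau_q q s (i : nat) : C := s * (-1) ^+ i.-1 / qint q i.

End Solutions.

Definition cis (R : realType) (x : R) : R[i] := (cos x +i* sin x)%C.

(* Main.v *)
(* Coefficientwise, sigma acts on the 2-step paths with fixed end points, and
   every connection of the given form is a torsion-free bimodule connection.
   Since nabla(w (x) e) = theta (x) w (x) e - sigma_12 sigma_23 (w (x) e (x) theta),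
   metric compatibility is one scalar equation for each 3-step path i -> i+1 or
   i+1 -> i; they all reduce to the recurrences that define the solution.
   Likewise nabla is *-preserving iff sigma dagger sigma = dagger on the elements
   w (x) theta; the first vertex gives |tau_1| = 1, and conversely |tau_1| = 1
   propagates to |tau_i|^2 = phi_i (phi_i - phi_{i+1}), which makes the 2x2 block
   M of sigma on the loops at a vertex satisfy M conj(M) = 1.
   The iteration for phi is linearized by phi_i = S_{i+1} / S_i, where
   S_{i+2} = phi_1 S_{i+1} - S_i; for phi_1 = q + 1/q this S_i is (i)_q, and
   S_{i+1}^2 - S_i S_{i+2} = 1 gives tau_i.  The choice phi_1 = 2 cos(pi/(n+1)) is
   the only positive one because every phi_i is increasing in phi_1. *)
Require Import Defs.
From mathcomp Require Import all_boot all_order all_algebra.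
From mathcomp Require Import mathcomp_extra boolp classical_sets functions.
From mathcomp Require Import reals topology normedtype trigo.
From mathcomp.real_closed Require Import complex.
From mathcomp Require Import zify ring.
Set Implicit Arguments.
Unset Strict Implicit.
Unset Printing Implicit Defensive.

Import Order.TTheory GRing.Theory Num.Theory.
Import numFieldNormedType.Exports.
Local Open Scope classical_set_scope.
Local Open Scope ring_scope.

(** * Coefficients and the braiding *)

(** Coefficients of arrows are Kronecker deltas written as coerced booleans; [lia] decides each of
    them, which leaves an identity for [ring]. *)
Ltac kill_deltas :=
  repeat match goal with
  | |- context [nat_of_bool ?b] =>
      first [ have -> : nat_of_bool b = 0%N by lia
            | have -> : nat_of_bool b = 1%N by lia ]
  end; rewrite ?mulr0n ?mulr1n.

Section Coefficients.
Context {C : numClosedFieldType}.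

Section Coef.
Context {T : Type} {P : pred T}.
Implicit Types F G : {x | P x} -> C^o.

Lemma coef_val F (x : {x | P x}) : coef F (val x) = F x.
Proof. by rewrite /coef valK. Qed.

Lemma coef_out F p : ~~ P p -> coef F p = 0.
Proof. by move=> Pp; rewrite /coef insubN. Qed.

Lemma coef_restr f p : coef (restr (P := P) f : {x | P x} -> C^o) p
  = if P p then f p else 0.
Proof. by rewrite /coef; case: insubP => [u -> <-|/negPf ->]. Qed.

Lemma coef_inj F G : (forall p, P p -> coef F p = coef G p) -> F = G.
Proof. by move=> eqFG; apply/funext => x; rewrite -!coef_val eqFG ?(valP x). Qed.

Lemma coef_add F G p : coef (F + G) p = coef F p + coef G p.
Proof. by rewrite /coef; case: insubP => [//|_]; rewrite addr0. Qed.

Lemma coef_opp F p : coef (- F) p = - coef F p.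
Proof. by rewrite /coef; case: insubP => [//|_]; rewrite oppr0. Qed.

Lemma coef_sub F G p : coef (F - G) p = coef F p - coef G p.
Proof. by rewrite coef_add coef_opp. Qed.

Lemma coef_scale k F p : coef (k *: F) p = k * coef F p.
Proof. by rewrite /coef; case: insubP => [//|_]; rewrite mulr0. Qed.

Lemma coef_zero p : coef (0 : {x | P x} -> C^o) p = 0.
Proof. by rewrite /coef; case: insubP. Qed.

End Coef.

(** At a fixed path the locally finite sums keep at most two terms: two when both edges at the
    starting vertex contribute. *)
Lemma big_pick (F : nat -> C) (j m : nat) :
  (j < m)%N -> (forall i, i != j -> F i = 0) -> \sum_(0 <= i < m) F i = F j.
Proof.
move=> jm F0; rewrite (bigD1_seq j) ?mem_index_iota ?iota_uniq //=.
by rewrite big1 ?addr0.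
Qed.

Lemma big_pick2 (F : nat -> C) (j k m : nat) :
  (j < m)%N -> (k < m)%N -> j != k ->
  (forall i, i != j -> i != k -> F i = 0) ->
  \sum_(0 <= i < m) F i = F j + F k.
Proof.
move=> jm km jk F0; rewrite (bigD1_seq j) ?mem_index_iota ?iota_uniq //=.
congr (_ + _); rewrite -big_filter (bigD1_seq k) ?filter_uniq ?iota_uniq //=.
  by rewrite big_filter_cond big1 ?addr0 // => i /andP[]; exact: F0.
by rewrite mem_filter mem_index_iota eq_sym jk.
Qed.

Variable N : option nat.

Lemma coef_sum1 F x y :
  coef (sum1 F : Omega1 C N) (x, y) = \sum_(0 <= i < x + y) coef (F i) (x, y).
Proof.
rewrite {1}/coef; case: insubP => [u _ eu|xy].
  by rewrite /sum1 eu; apply: eq_bigr => i _; rewrite -eu coef_val.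
by rewrite big1 // => i _; rewrite coef_out.
Qed.

Lemma coef_sum2 F x y z :
  coef (sum2 F : Tens2 C N) (x, y, z)
  = \sum_(0 <= i < x + y + z) coef (F i) (x, y, z).
Proof.
rewrite {1}/coef; case: insubP => [u _ eu|xy].
  by rewrite /sum2 eu; apply: eq_bigr => i _; rewrite -eu coef_val.
by rewrite big1 // => i _; rewrite coef_out.
Qed.

Lemma coef_sum3 F x y z t :
  coef (sum3 F : Tens3 C N) (x, y, z, t)
  = \sum_(0 <= i < x + y + z + t) coef (F i) (x, y, z, t).
Proof.
rewrite {1}/coef; case: insubP => [u _ eu|xy].
  by rewrite /sum3 eu; apply: eq_bigr => i _; rewrite -eu coef_val.
by rewrite big1 // => i _; rewrite coef_out.
Qed.

Lemma adjC x y : adj N x y = adj N y x.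
Proof. by rewrite /adj orbC; case: is_vertex; case: is_vertex. Qed.

Lemma coef_arrow a b x y :
  coef (@arrow C N a b) (x, y) = (adj N x y && ((x, y) == (a, b)))%:R.
Proof. by rewrite coef_restr /is_arrow /=; case: adj. Qed.

Lemma coef_tens (w e : Omega1 C N) x y z :
  coef (tens w e) (x, y, z) = coef w (x, y) * coef e (y, z).
Proof.
rewrite coef_restr /is_path2 /=; case: ifP => // /negbT; rewrite negb_and.
case/orP=> H; first by rewrite (@coef_out _ _ w (x, y) H) mul0r.
by rewrite (@coef_out _ _ e (y, z) H) mulr0.
Qed.

Lemma coef_tens21 (S : Tens2 C N) (w : Omega1 C N) x y z t :
  coef (tens21 S w) (x, y, z, t) = coef S (x, y, z) * coef w (z, t).
Proof.
rewrite coef_restr /is_path3 /=; case: ifP => // /negbT; rewrite negb_and.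
case/orP=> H; first by rewrite (@coef_out _ _ S (x, y, z) H) mul0r.
by rewrite (@coef_out _ _ w (z, t) H) mulr0.
Qed.

(** The case analysis used throughout. Both kinds of loop are indexed by the lower vertex of their
    edge, so that one hypothesis [adj N x x.+1] serves for either. *)
Lemma path2_ind (P : nat -> nat -> nat -> Prop) :
  (forall x, P x x.+1 x.+2) -> (forall x, P x.+2 x.+1 x) ->
  (forall x, adj N x x.+1 -> P x x.+1 x) ->
  (forall x, adj N x x.+1 -> P x.+1 x x.+1) ->
  forall x y z, is_path2 N (x, y, z) -> P x y z.
Proof.
move=> P1 P2 P3 P4 x y z /andP[/= xy].
have /and3P[_ _ /orP[/eqP ey|/eqP ex]] := xy;
  subst=> /and3P[_ _ /orP[/eqP ez|/eqP]].
- by rewrite ez; exact: P1.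
- by case=> <-; exact: P3.
- by rewrite ez; apply: P4; rewrite adjC.
- by move->; exact: P2.
Qed.

Lemma is_path2_loop x : is_path2 N (x, x.+1, x) = adj N x x.+1.
Proof. by rewrite /is_path2 /= adjC andbb. Qed.

Lemma is_path2_loop' x : is_path2 N (x.+1, x, x.+1) = adj N x x.+1.
Proof. by rewrite /is_path2 /= [adj N x.+1 x]adjC andbb. Qed.

Lemma adj_gt0 x y : adj N x y -> (0 < x)%N.
Proof. by case/and3P=> /andP[]. Qed.

Lemma coef_theta x y : coef (@theta C N) (x, y) = (adj N x y)%:R.
Proof.
rewrite coef_sum1; case: (boolP (adj N x y)) => xy; last first.
  by rewrite big1 // => i _; rewrite coef_out.
have x0 := adj_gt0 xy; have y0 : (0 < y)%N by move: xy; rewrite adjC;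
  exact: adj_gt0.
under eq_bigr => i _ do rewrite coef_add !coef_arrow xy /= !xpair_eqE -natrD.
case/and3P: xy => _ _ /orP[/eqP ey|/eqP ex]; subst.
  by rewrite (big_pick (j := x)) => [||i ix]; [kill_deltas | lia | have
    -> : ((x == i) && (x.+1 == i.+1) + (x == i.+1) && (x.+1 == i) = 0)%N by lia].
by rewrite (big_pick (j := y)) => [||i ix]; [kill_deltas | lia | have
  -> : ((y.+1 == i) && (y == i.+1) + (y.+1 == i.+1) && (y == i) = 0)%N by lia].
Qed.

End Coefficients.

(** * The braiding on each shape of 2-step path *)

Section Sigma.
Context {C : numClosedFieldType} {N : option nat}.
Variable c : coeffs C.
Implicit Types (T : Tens2 C N).

Lemma sigma_up T x :
  coef (sigma N c T) (x, x.+1, x.+2) = c_sig c x * coef T (x, x.+1, x.+2).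
Proof.
case: (boolP (is_path2 N (x, x.+1, x.+2))) => [/andP[/= p1 p2]|p]; last first.
  by rewrite !coef_out ?mulr0.
have x0 := adj_gt0 p1.
rewrite coef_sum2 (big_pick (j := x)) => [||i ix]; [|lia|].
- rewrite !(coef_add, coef_scale, coef_tens, coef_arrow) p1 p2 /= !xpair_eqE.
  by kill_deltas; ring.
- rewrite !(coef_add, coef_scale, coef_tens, coef_arrow) p1 p2 /= !xpair_eqE.
  by kill_deltas; ring.
Qed.

Lemma sigma_down T x :
  coef (sigma N c T) (x.+2, x.+1, x) = c_sig' c x.+1 * coef T (x.+2, x.+1, x).
Proof.
case: (boolP (is_path2 N (x.+2, x.+1, x))) => [/andP[/= p1 p2]|p]; last first.
  by rewrite !coef_out ?mulr0.
have x0 : (0 < x)%N by move: p2; rewrite adjC; exact: adj_gt0.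
(* The falling path starts with a'_{x+1}, hence the index x+1. *)
rewrite coef_sum2 (big_pick (j := x.+1)) => [||i ix]; [|lia|].
- rewrite !(coef_add, coef_scale, coef_tens, coef_arrow) p1 p2 /= !xpair_eqE.
  by kill_deltas; ring.
- rewrite !(coef_add, coef_scale, coef_tens, coef_arrow) p1 p2 /= !xpair_eqE.
  by kill_deltas; ring.
Qed.

(** On the two loops at a vertex [sigma] is a 2x2 block, of which this is one row. At vertex 1 the
    second term vanishes by default, because [coef] is 0 at a path through 0. *)
Lemma sigma_loop T x : adj N x x.+1 ->
  coef (sigma N c T) (x, x.+1, x) =
  c_tau c x * coef T (x, x.+1, x) + (1 + c_tau' c x.-1) * coef T (x, x.-1, x).
Proof.
move=> p1; have p2 : adj N x.+1 x by rewrite adjC.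
have x0 := adj_gt0 p1.
rewrite coef_sum2 (big_pick2 (j := x) (k := x.-1)) => [||||i ix ix'];
  [|lia|lia|lia|].
- rewrite !(coef_add, coef_scale, coef_tens, coef_arrow) p1 p2 /= !xpair_eqE.
  by kill_deltas; rewrite (ltn_predK x0); ring.
- rewrite !(coef_add, coef_scale, coef_tens, coef_arrow) p1 p2 /= !xpair_eqE.
  by kill_deltas; ring.
Qed.

(** The other row of the block, now at the vertex [x.+1]; at a last vertex its second term vanishes
    by default. *)
Lemma sigma_loop' T x : adj N x x.+1 ->
  coef (sigma N c T) (x.+1, x, x.+1) =
  c_tau' c x * coef T (x.+1, x, x.+1)
  + (1 + c_tau c x.+1) * coef T (x.+1, x.+2, x.+1).
Proof.
move=> p1; have p2 : adj N x.+1 x by rewrite adjC.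
have x0 := adj_gt0 p1.
rewrite coef_sum2 (big_pick2 (j := x) (k := x.+1)) => [||||i ix ix'];
  [|lia|lia|lia|].
- rewrite !(coef_add, coef_scale, coef_tens, coef_arrow) p1 p2 /= !xpair_eqE.
  by kill_deltas; ring.
- rewrite !(coef_add, coef_scale, coef_tens, coef_arrow) p1 p2 /= !xpair_eqE.
  by kill_deltas; ring.
Qed.

(* [sigma] preserves the end points of paths. *)
Lemma sigma_local k S T x y z :
  (forall u, coef S (x, u, z) = k * coef T (x, u, z)) ->
  coef (sigma N c S) (x, y, z) = k * coef (sigma N c T) (x, y, z).
Proof.
case: (boolP (is_path2 N (x, y, z))) => [p|p _]; last first.
  by rewrite !coef_out ?mulr0.
elim/path2_ind: p => {x y z} [x|x|x xe|x xe] ST.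
- by rewrite !sigma_up ST; ring.
- by rewrite !sigma_down ST; ring.
- by rewrite !sigma_loop // !ST; ring.
- by rewrite !sigma_loop' // !ST; ring.
Qed.

Lemma sigma_linear k S T : sigma N c (k *: S + T) = k *: sigma N c S + sigma N c T.
Proof.
apply: coef_inj => -[[x y] z]; elim/path2_ind => {x y z} [x|x|x xe|x xe].
- by rewrite !(sigma_up, coef_add, coef_scale); ring.
- by rewrite !(sigma_down, coef_add, coef_scale); ring.
- by rewrite !(coef_add, coef_scale) !sigma_loop // !(coef_add, coef_scale); ring.
- by rewrite !(coef_add, coef_scale) !sigma_loop' // !(coef_add, coef_scale); ring.
Qed.

Lemma sigmaD S T : sigma N c (S + T) = sigma N c S + sigma N c T.
Proof. by rewrite -[S]scale1r sigma_linear !scale1r. Qed.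

Lemma sigma0 : sigma N c 0 = 0.
Proof. by apply: (addrI (sigma N c 0)); rewrite -sigmaD !addr0. Qed.

Lemma sigmaN S : sigma N c (- S) = - sigma N c S.
Proof. by apply: (addrI (sigma N c S)); rewrite -sigmaD !subrr sigma0. Qed.

(** The actions of functions scale a coefficient by a factor that depends only on the end points of
    the path, so [sigma_local] applies. *)
Lemma sigma_bimodule_map : bimodule_map (sigma N c).
Proof.
have coefl f T' x u z : coef (lact2 f T') (x, u, z) = coef f x * coef T' (x, u, z).
  by rewrite coef_restr; case: ifP => // /negbT p;
    rewrite [coef T' _]coef_out ?mulr0.
have coefr f T' x u z : coef (ract2 T' f) (x, u, z) = coef f z * coef T' (x, u, z).
  by rewrite coef_restr mulrC; case: ifP => // /negbT p;
    rewrite [coef T' _]coef_out ?mulr0.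
split=> [k S T|f T|T f]; first exact: sigma_linear.
  apply: coef_inj => -[[x y] z] _; rewrite coefl.
  by apply: sigma_local => u; rewrite coefl.
apply: coef_inj => -[[x y] z] _; rewrite coefr.
by apply: sigma_local => u; rewrite coefr.
Qed.

End Sigma.

(** * Leibniz rules and torsion *)

Section Nabla.
Context {C : numClosedFieldType} {N : option nat}.
Variable c : coeffs C.
Implicit Types (T : Tens2 C N) (f : Alg C N) (w e : Omega1 C N).

Lemma coef_lact1 f w x y : coef (lact1 f w) (x, y) = coef f x * coef w (x, y).
Proof. by rewrite coef_restr; case: ifP => // /negbT p;
  rewrite [coef w _]coef_out ?mulr0. Qed.

Lemma coef_ract1 w f x y : coef (ract1 w f) (x, y) = coef w (x, y) * coef f y.
Proof. by rewrite coef_restr; case: ifP => // /negbT p;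
  rewrite [coef w _]coef_out ?mul0r. Qed.

Lemma coef_lact2 f T x y z :
  coef (lact2 f T) (x, y, z) = coef f x * coef T (x, y, z).
Proof. by rewrite coef_restr; case: ifP => // /negbT p;
  rewrite [coef T _]coef_out ?mulr0. Qed.

Lemma coef_ract2 T f x y z :
  coef (ract2 T f) (x, y, z) = coef T (x, y, z) * coef f z.
Proof. by rewrite coef_restr; case: ifP => // /negbT p;
  rewrite [coef T _]coef_out ?mul0r. Qed.

Lemma coef_d0 f x y : coef (d0 f) (x, y) = (adj N x y)%:R * (coef f y - coef f x).
Proof.
rewrite coef_sum1; case: (boolP (adj N x y)) => xy; last first.
  by rewrite mul0r big1 // => i _; rewrite coef_out.
have x0 := adj_gt0 xy; have y0 : (0 < y)%N by move: xy; rewrite adjC;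
  exact: adj_gt0.
under eq_bigr => i _ do rewrite coef_scale coef_sub !coef_arrow xy /= !xpair_eqE.
case/and3P: xy => _ _ /orP[/eqP ey|/eqP ex]; subst.
  by rewrite (big_pick (j := x)) => [||i ix]; [|lia|]; kill_deltas; ring.
by rewrite (big_pick (j := y)) => [||i ix]; [|lia|]; kill_deltas; ring.
Qed.

Lemma tens_linearl k w w' e : tens (k *: w + w') e = k *: tens w e + tens w' e.
Proof.
apply: coef_inj => -[[x y] z] _.
by rewrite !(coef_add, coef_scale, coef_tens); ring.
Qed.

Lemma tens_linearr k w e e' : tens w (k *: e + e') = k *: tens w e + tens w e'.
Proof.
apply: coef_inj => -[[x y] z] _.
by rewrite !(coef_add, coef_scale, coef_tens); ring.
Qed.

(** The differential is inner, d f = theta f - f theta, and [sigma] respects both actions, so the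
    two Leibniz rules are formal. *)
Lemma nabla_bimodule_connection : bimodule_connection (nabla N c) (sigma N c).
Proof.
split=> [k w w'||f w|w f].
- rewrite /nabla tens_linearl tens_linearr sigma_linear.
  by apply: coef_inj => p _; rewrite !(coef_add, coef_opp, coef_scale); ring.
- exact: sigma_bimodule_map.
- apply: coef_inj => -[[x y] z] _.
  rewrite /nabla coef_sub coef_add coef_lact2 coef_sub !coef_tens coef_lact1
    coef_theta.
  rewrite coef_d0 (@sigma_local _ _ c (coef f x) _ (tens w (@theta C N)));
    first ring.
  by move=> u; rewrite !coef_tens coef_lact1; ring.
- have -> : tens w (d0 f)
    = ract2 (tens w (@theta C N)) f - tens (ract1 w f) (@theta C N).
    apply: coef_inj => -[[x y] z] _.
    by rewrite coef_sub coef_ract2 !coef_tens coef_theta coef_d0 coef_ract1; ring.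
  have [_ _ sigmar] := @sigma_bimodule_map C N c.
  rewrite sigmaD sigmaN sigmar; apply: coef_inj => -[[x y] z] _.
  rewrite !(coef_add, coef_opp) !coef_ract2 !(coef_add,
    coef_opp) !coef_tens coef_ract1.
  by ring.
Qed.

(** The difference of the two sides is -(1 + [sigma]) applied to w (x) theta, and 1 + [sigma] takes
    each 2-step path to a multiple of a relation; this is why the off-diagonal entries are 1 + tau
    and 1 + tau'. *)
Lemma nabla_torsion_free w :
  wedge_eq (nabla N c w) (tens (@theta C N) w + tens w (@theta C N)).
Proof.
set T := tens w (@theta C N).
have -> : nabla N c w = tens (@theta C N) w + - sigma N c T by [].
rewrite /wedge_eq opprD addrACA subrr add0r.
(* The multipliers are read off from 1 + [sigma]; the third relation of index i lives at the vertex
   i+1 and collects both loops there. *)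
exists (fun i => - ((1 + c_sig c i) * coef T (i, i.+1, i.+2))).
exists (fun i => - ((1 + c_sig' c i.+1) * coef T (i.+2, i.+1, i))).
exists (fun i => - ((1 + c_tau c i.+1) * coef T (i.+1, i.+2, i.+1)
                    + (1 + c_tau' c i) * coef T (i.+1, i, i.+1))).
apply: coef_inj => -[[x y] z] p; have := p; move: p.
elim/path2_ind => {x y z} [x|x|x p1|x p1] p; rewrite coef_add !coef_opp.
- have /andP[/= p1 p2] := p; have x0 := adj_gt0 p1.
  rewrite sigma_up coef_sum2 (big_pick (j := x)) => [||i ix]; [|lia|];
  rewrite !(coef_add, coef_scale, coef_tens, coef_arrow) p1 p2 /= !xpair_eqE.
    by kill_deltas; ring.
  by kill_deltas; ring.
- have /andP[/= p1 p2] := p.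
  rewrite sigma_down coef_sum2 (big_pick (j := x)) => [||i ix]; [|lia|];
  rewrite !(coef_add, coef_scale, coef_tens, coef_arrow) p1 p2 /= !xpair_eqE.
    by kill_deltas; ring.
  by kill_deltas; ring.
- have p2 : adj N x.+1 x by rewrite adjC.
  have x0 := adj_gt0 p1.
  rewrite sigma_loop // coef_sum2 (big_pick (j := x.-1)) => [||i ix]; [|lia|].
    rewrite (ltn_predK x0) !(coef_add,
      coef_scale) [coef (tens (@a_ C N _) _) _]coef_tens.
    rewrite !(coef_tens (arrow C _ _)) !coef_arrow p1 p2 /= !xpair_eqE.
    by kill_deltas; ring.
  rewrite !(coef_add, coef_scale) !(coef_tens (arrow C _ _)) !coef_arrow p1 p2
    /= !xpair_eqE.
  by kill_deltas; ring.
- have p2 : adj N x.+1 x by rewrite adjC.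
  rewrite sigma_loop' // coef_sum2 (big_pick (j := x)) => [||i ix]; [|lia|];
  rewrite !(coef_add, coef_scale) !(coef_tens (arrow C _ _)) !coef_arrow p1 p2
    /= !xpair_eqE.
    by kill_deltas; ring.
  by kill_deltas; ring.
Qed.

End Nabla.

(** * The metric and the extension of the connection to 2-tensors *)

Section Metric.
Context {C : numClosedFieldType} {N : option nat}.
Implicit Types (g T : Tens2 C N) (w e : Omega1 C N).

Lemma coef_slice_rE T z t u v :
  coef (slice_r T z t) (u, v) = if v == z then coef T (u, z, t) else 0.
Proof.
rewrite coef_restr; case: (v =P z) => [->|_]; case: ifP => // /negbT p.
by rewrite coef_out // /is_path2 negb_and p.
Qed.

Lemma coef_slice_r T z t u : coef (slice_r T z t) (u, z) = coef T (u, z, t).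
Proof. by rewrite coef_slice_rE eqxx. Qed.

Lemma coef_slice_l T x y z : coef (slice_l T x y) (y, z) = coef T (x, y, z).
Proof.
rewrite coef_restr eqxx; case: ifP => // /negbT p.
by rewrite coef_out // /is_path2 negb_and orbC p.
Qed.

(** Equivalently, the tensor commutes with all functions. *)
Definition central g := forall x y z, x != z -> coef g (x, y, z) = 0.

Lemma central_is_metric g : central g ->
  (forall x y, adj N x y -> coef g (x, y, x) != 0) -> is_metric g.
Proof.
move=> g0 gn0.
(* The inverse metric pairs an arrow with its reverse: the loop x -> y -> x is divided by the
   coefficient of g at y -> x -> y. A loop outside the graph contributes 0. *)
pose f T i := coef T (i, i.+1, i) / coef g (i.+1, i, i.+1)
             + coef T (i, i.-1, i) / coef g (i.-1, i, i.-1).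
exists (fun T => restr (f T)); split.
- move=> k S T; apply: coef_inj => i p.
  by rewrite [RHS]coef_add coef_scale !coef_restr p /f !(coef_add, coef_scale);
    ring.
- move=> a T i; rewrite !coef_restr; case: ifP => p; last by rewrite mulr0.
  by rewrite /f !coef_lact2; ring.
- move=> T a i; rewrite !coef_restr; case: ifP => p; last by rewrite mul0r.
  by rewrite /f !coef_ract2; ring.
move=> w; split; apply: coef_inj => -[x y] p; rewrite coef_restr p coef_restr.
- have /and3P[/= vx _ xy] := p; rewrite vx /f !coef_tens !coef_slice_r.
  case/orP: xy p => /eqP-> p.
    by rewrite (g0 x.-1) ?mulfK ?gn0 1?adjC //; [ring | lia].
  by rewrite (g0 _.+2) ?mulfK ?gn0 1?adjC //; [rewrite mulr0 mul0r add0r|lia].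
- have /and3P[/= _ vy xy] := p; rewrite vy /f !coef_tens !coef_slice_l.
  case/orP: xy p => /eqP-> p /=.
    rewrite (g0 x x.+1 x.+2) ?mul0r ?add0r; last by lia.
    by rewrite mulrAC divff ?mul1r // gn0.
  rewrite (g0 y.+1 y y.-1) ?mul0r ?addr0; last by lia.
  by rewrite mulrAC divff ?mul1r // gn0 // adjC.
Qed.

Lemma coef_metric_loop h phi eps x : adj N x x.+1 ->
  coef (metric N h phi eps : Tens2 C N) (x, x.+1, x) = h x * phi x.
Proof.
move=> p1; have p2 : adj N x.+1 x by rewrite adjC.
rewrite coef_sum2 (big_pick (j := x)) => [||i ix]; [|lia|];
rewrite !(coef_scale, coef_add, coef_tens, coef_arrow) p1 p2 /= !xpair_eqE.
  by kill_deltas; ring.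
by kill_deltas; ring.
Qed.

Lemma coef_metric_loop' h phi eps x : adj N x x.+1 ->
  coef (metric N h phi eps : Tens2 C N) (x.+1, x, x.+1) = eps * h x.
Proof.
move=> p1; have p2 : adj N x.+1 x by rewrite adjC.
rewrite coef_sum2 (big_pick (j := x)) => [||i ix]; [|lia|];
rewrite !(coef_scale, coef_add, coef_tens, coef_arrow) p1 p2 /= !xpair_eqE.
  by kill_deltas; ring.
by kill_deltas; ring.
Qed.

Lemma metric_central h phi eps : central (metric N h phi eps : Tens2 C N).
Proof.
move=> x y z xz; rewrite coef_sum2 big1 // => i _.
rewrite !(coef_scale, coef_add, coef_tens, coef_arrow) !xpair_eqE.
rewrite -!natrM !mulnb.
have -> : (adj N x y && ((x == i) && (y == i.+1))) && (adj N y z && ((y ==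
  i.+1) && (z == i))) = false by lia.
have -> : (adj N x y && ((x == i.+1) && (y == i))) && (adj N y z && ((y == i)
  && (z == i.+1))) = false by lia.
by rewrite !mulr0 addr0 mulr0.
Qed.

Variable c : coeffs C.
Local Notation theta := (@theta C N).
Local Notation al := (@a_ C N).
Local Notation al' := (@a'_ C N).

(** The two middle terms cancel: -[sigma] (w (x) theta) (x) e from the first summand of
    [nabla_tens], and the part of the second that comes from theta (x) e. *)
Lemma coef_nabla_tens w e x y z t : is_path3 N (x, y, z, t) ->
  coef (nabla_tens (nabla N c) (sigma N c) w e) (x, y, z, t) =
  coef theta (x, y) * coef w (y, z) * coef e (z, t)
  - coef (sigma N c (tens w (slice_r (sigma N c (tens e theta)) z t))) (x, y, z).
Proof.
move=> p; rewrite coef_add coef_tens21 coef_sub coef_tens coef_restr p.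
have -> : tens w (slice_r (nabla N c e) z t)
  = tens w (slice_r (tens theta e) z t)
    - tens w (slice_r (sigma N c (tens e theta)) z t).
  apply: coef_inj => -[[x1 y1] z1] _;
    rewrite coef_sub ![coef (tens w _) _]coef_tens !coef_slice_rE.
  by case: ifP => _; rewrite ?coef_sub; ring.
rewrite sigmaD sigmaN coef_sub.
rewrite (@sigma_local _ _ c (coef e (z,
  t)) (tens w (slice_r (tens theta e) z t)) (tens w theta)).
  by ring.
by move=> u; rewrite !coef_tens coef_slice_r coef_tens; ring.
Qed.

(** Reassembles g from its loops, which turns the sum of the terms theta (x) w (x) e into theta (x)
    g. *)
Lemma central_expand g y z t m : central g -> is_path2 N (y, z, t) ->
  (y < m)%N -> (z < m)%N ->
  \sum_(0 <= i < m)
    (coef g (i, i.+1, i) * (coef (al i) (y, z) * coef (al' i) (z, t))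
     + coef g (i.+1, i, i.+1) * (coef (al' i) (y, z) * coef (al i) (z, t)))
  = coef g (y, z, t).
Proof.
move=> g0 p ym zm; have /andP[/= p1 p2] := p.
under eq_bigr => i _ do rewrite !coef_arrow p1 p2 /= !xpair_eqE.
elim/path2_ind: p ym zm {p1 p2} => {y z t} [x|x|x p|x p] ym zm.
- rewrite g0; last by lia.
  by rewrite big1 // => i _; kill_deltas; ring.
- rewrite g0; last by lia.
  by rewrite big1 // => i _; kill_deltas; ring.
- by rewrite (big_pick (j := x)) => [|//|i ix]; kill_deltas; ring.
- by rewrite (big_pick (j := x)) => [|//|i ix]; kill_deltas; ring.
Qed.

(** The braiding keeps the starting vertex x, so only the two loops of g based at x contribute; [s1]
    and [s2] are the values of sigma_12 sigma_23 on them. *)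
Lemma coef_nabla2 g x y z t s1 s2 : central g -> is_path3 N (x, y, z, t) ->
  coef (sigma N c (tens (al x)
    (slice_r (sigma N c (tens (al' x) theta)) z t))) (x, y, z) = s1 ->
  coef (sigma N c (tens (al' x.-1)
    (slice_r (sigma N c (tens (al x.-1) theta)) z t))) (x, y, z) = s2 ->
  coef (nabla2 (nabla N c) (sigma N c) g) (x, y, z, t) =
  coef g (y, z, t) - (coef g (x, x.+1, x) * s1 + coef g (x, x.-1, x) * s2).
Proof.
move=> g0 p <- <-; have /andP[/= p2 p1] := p; have /andP[/= p0 p1'] := p2.
have x0 := adj_gt0 p0.
rewrite coef_sum3.
have coef_lin4 k1 k2 k3 k4 (F1 F2 F3 F4 : Tens3 C N) q :
    coef (k1 *: F1 + k2 *: F2 + k3 *: F3 + k4 *: F4) q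
    = k1 * coef F1 q + k2 * coef F2 q + k3 * coef F3 q + k4 * coef F4 q.
  by rewrite !coef_add !coef_scale.
(* The rising and falling paths drop out because g is central. *)
have lin4_tail (k1 k2 k3 k4 n1 n2 n3 n4 th a1 a2 a3 b1 b2 b3 : C) :
    k1 = 0 -> k2 = 0 -> n3 = th * a1 * a2 - a3 -> n4 = th * b1 * b2 - b3 ->
    k1 * n1 + k2 * n2 + k3 * n3 + k4 * n4
    = th * (k3 * (a1 * a2) + k4 * (b1 * b2)) - (k3 * a3 + k4 * b3).
  by move=> -> -> -> ->; ring.
pose A i := coef theta (x, y) *
  (coef g (i, i.+1, i) * (coef (al i) (y, z) * coef (al' i) (z, t))
     + coef g (i.+1, i, i.+1) * (coef (al' i) (y, z) * coef (al i) (z, t))).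
pose B i := coef g (i, i.+1, i)
     * coef (sigma N c (tens (al i)
              (slice_r (sigma N c (tens (al' i) theta)) z t))) (x, y, z).
pose B' i := coef g (i.+1, i, i.+1)
     * coef (sigma N c (tens (al' i)
              (slice_r (sigma N c (tens (al i) theta)) z t))) (x, y, z).
rewrite (eq_bigr (fun i => A i - (B i + B' i))) => [|i _]; last first.
  rewrite coef_lin4; apply: lin4_tail; try (by apply: g0; lia).
    exact: coef_nabla_tens.
  exact: coef_nabla_tens.
rewrite sumrB -big_distrr /= central_expand //;
  [rewrite coef_theta p0 mul1r|by rewrite /is_path2 /= p1' p1|lia|lia].
have xy : (0 < y)%N by move: p1'; exact: adj_gt0.
(* Locality with factor 0: the argument of [sigma] has no path starting at x. *)
have Bi i : i != x -> B i = 0.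
  move=> ix; rewrite /B (@sigma_local _ _ c 0 _ 0); first by rewrite mul0r mulr0.
  move=> u; rewrite coef_tens coef_arrow xpair_eqE mul0r.
  have -> : adj N x u && ((x == i) && (u == i.+1)) = false by lia.
  by rewrite mulr0n mul0r.
have B'i i : i != x.-1 -> B' i = 0.
  move=> ix; rewrite /B' (@sigma_local _ _ c 0 _ 0); first by rewrite mul0r mulr0.
  move=> u; rewrite coef_tens coef_arrow xpair_eqE mul0r.
  have -> : adj N x u && ((x == i.+1) && (u == i)) = false by lia.
  by rewrite mulr0n mul0r.
congr (_ - _); rewrite (big_pick2 (j := x) (k := x.-1)) => [||||i ix ix'];
  [|lia|lia|lia|by rewrite -/(B i) -/(B' i) Bi // B'i // addr0].
rewrite -!/(B _) -!/(B' _) B'i ?(Bi x.-1); [|lia|lia].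
by rewrite addr0 add0r /B /B' (ltn_predK x0).
Qed.
End Metric.

(** * The braiding on tensors that begin with a single arrow *)

Section SigmaArrow.
Context {C : numClosedFieldType} {N : option nat}.
Variables (c : coeffs C) (e : Omega1 C N).
Local Notation E x := (adj N x x.+1).
Local Notation al := (@a_ C N).
Local Notation al' := (@a'_ C N).

Lemma coef_al x : E x -> coef (al x) (x, x.+1) = 1.
Proof. by move=> p; rewrite coef_arrow p eqxx. Qed.

Lemma coef_al' x : E x -> coef (al' x) (x.+1, x) = 1.
Proof. by move=> p; rewrite coef_arrow adjC p eqxx. Qed.

Lemma coef_al0 x y z : ~~ (y < z)%N -> coef (al x) (y, z) = 0.
Proof.
move=> yz; rewrite coef_arrow xpair_eqE.
by have -> : adj N y z && ((y == x) && (z == x.+1)) = false by lia.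
Qed.

Lemma coef_al'0 x y z : ~~ (z < y)%N -> coef (al' x) (y, z) = 0.
Proof.
move=> yz; rewrite coef_arrow xpair_eqE.
by have -> : adj N y z && ((y == x.+1) && (z == x)) = false by lia.
Qed.

Lemma sigma_al_up x : E x ->
  coef (sigma N c (tens (al x) e)) (x, x.+1, x.+2)
    = c_sig c x * coef e (x.+1, x.+2).
Proof. by move=> p; rewrite sigma_up coef_tens coef_al // mul1r. Qed.

Lemma sigma_al_down x : coef (sigma N c (tens (al x.+2) e)) (x.+2, x.+1, x) = 0.
Proof. by rewrite sigma_down coef_tens coef_al0 ?mul0r ?mulr0 //; lia. Qed.

Lemma sigma_al_loop x : E x ->
  coef (sigma N c (tens (al x) e)) (x, x.+1, x) = c_tau c x * coef e (x.+1, x).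
Proof.
move=> p; rewrite sigma_loop // !coef_tens coef_al // coef_al0; last by lia.
by rewrite mul1r mul0r mulr0 addr0.
Qed.

Lemma sigma_al_loop' x : E x -> E x.+1 ->
  coef (sigma N c (tens (al x.+1) e)) (x.+1, x, x.+1)
  = (1 + c_tau c x.+1) * coef e (x.+2, x.+1).
Proof.
move=> p p'; rewrite sigma_loop' // !coef_tens coef_al // coef_al0; last by lia.
by rewrite mul1r mul0r mulr0 add0r.
Qed.

Lemma sigma_al'_up x : coef (sigma N c (tens (al' x) e)) (x.+1, x.+2, x.+3) = 0.
Proof. by rewrite sigma_up coef_tens coef_al'0 ?mul0r ?mulr0 //; lia. Qed.

Lemma sigma_al'_down x : E x.+1 ->
  coef (sigma N c (tens (al' x.+1) e)) (x.+2, x.+1, x)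
    = c_sig' c x.+1 * coef e (x.+1, x).
Proof. by move=> p; rewrite sigma_down coef_tens coef_al' // mul1r. Qed.

Lemma sigma_al'_loop' x : E x ->
  coef (sigma N c (tens (al' x) e)) (x.+1, x, x.+1) = c_tau' c x * coef e (x, x.+1).
Proof.
move=> p; rewrite sigma_loop' // !coef_tens coef_al' // coef_al'0; last by lia.
by rewrite mul1r mul0r mulr0 addr0.
Qed.

Lemma sigma_al'_loop x : E x -> E x.+1 ->
  coef (sigma N c (tens (al' x) e)) (x.+1, x.+2, x.+1)
  = (1 + c_tau' c x) * coef e (x, x.+1).
Proof.
move=> p p'; rewrite sigma_loop // !coef_tens coef_al' // coef_al'0; last by lia.
by rewrite mul1r mul0r mulr0 add0r.
Qed.

End SigmaArrow.

(** * Metric compatibility as scalar equations *)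

Section LeviCivita.
Context {C : numClosedFieldType} {N : option nat}.
Variables (c : coeffs C) (g : Tens2 C N).
Local Notation E x := (adj N x x.+1).
Local Notation al := (@a_ C N).
Local Notation al' := (@a'_ C N).
Local Notation theta := (@theta C N).
Local Notation up x := (coef g (x, x.+1, x)).
Local Notation dn x := (coef g (x.+1, x, x.+1)).
Local Notation tau i := (c_tau c i).
Local Notation tau' i := (c_tau' c i).
Local Notation sig i := (c_sig c i).
Local Notation sig' i := (c_sig' c i).

(* One equation for each of the families of 3-step paths (i, i+1, i, i+1),
   (i+1, i, i+1, i), (i, i-1, i, i+1), (i, i+1, i, i-1), (i, i+1, i+2, i+1) and
   (i, i-1, i-2, i-1). *)
Lemma nabla2_eq0 : central g ->
  (forall x, E x.+1 ->
    dn x.+1 = tau x.+1 * tau' x.+1 * up x.+1 + (1 + tau' x) * sig x * dn x) ->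
  (forall x, E x ->
    up x = tau x * tau' x * dn x + (1 + tau x.+1) * sig' x.+1 * up x.+1) ->
  (forall x, E x -> E x.+1 ->
    (1 + tau x.+1) * tau' x.+1 * up x.+1 + tau' x * sig x * dn x = 0) ->
  (forall x, E x -> E x.+1 ->
    (1 + tau' x) * tau x * dn x + tau x.+1 * sig' x.+1 * up x.+1 = 0) ->
  (forall x, E x -> E x.+1 -> up x.+1 = sig x * (1 + tau' x) * up x) ->
  (forall x, E x -> E x.+1 -> dn x = sig' x.+1 * (1 + tau x.+1) * dn x.+1) ->
  nabla2 (nabla N c) (sigma N c) g = 0.
Proof.
move=> g0 eA eA' eB eB' eD eD'.
apply: coef_inj => -[[[x y] z] t] p; rewrite coef_zero.
have /andP[/= p2 p1] := p; move: p p1.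
elim/path2_ind: p2 => {x y z} [x|x|x ex|x ex] p p1.
- have /andP[/andP[/= e1 e2] e3] := p.
  have t2 : coef (sigma N c (tens (al' x.-1)
    (slice_r (sigma N c (tens (al x.-1) theta)) x.+2 t))) (x, x.+1, x.+2) = 0.
    by case: x e1 {p p1 e2 e3} => // x e1; exact: sigma_al'_up.
  case/and3P: p1 => _ _ /orP[/eqP et|/eqP[et]]; subst t.
    (* When the end points are at distance 3 every term vanishes. *)
    have t1 : coef (sigma N c (tens (al x)
      (slice_r (sigma N c (tens (al' x) theta)) x.+2 x.+3))) (x, x.+1, x.+2) = 0.
      by rewrite sigma_al_up // coef_slice_r sigma_al'_up mulr0.
    by rewrite (coef_nabla2 g0 p t1 t2) g0 ?(mulr0, addr0, subr0) //; lia.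
  have t1 : coef (sigma N c (tens (al x)
      (slice_r (sigma N c (tens (al' x) theta)) x.+2 x.+1))) (x, x.+1, x.+2)
      = sig x * (1 + tau' x).
    by rewrite sigma_al_up // coef_slice_r sigma_al'_loop // coef_theta e1 mulr1.
  by rewrite (coef_nabla2 g0 p t1 t2) eD //; ring.
- have /andP[/andP[/= e1 e2] e3] := p; rewrite adjC in e1; rewrite adjC in e2.
  have t1 : coef (sigma N c (tens (al x.+2)
    (slice_r (sigma N c (tens (al' x.+2) theta)) x t))) (x.+2, x.+1, x) = 0.
    exact: sigma_al_down.
  case/and3P: p1 => _ _ /orP[/eqP et|/eqP et]; subst.
    have t2 : coef (sigma N c (tens (al' x.+1)
      (slice_r (sigma N c (tens (al x.+1) theta)) x x.+1))) (x.+2, x.+1, x)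
      = sig' x.+1 * (1 + tau x.+1).
      by rewrite sigma_al'_down // coef_slice_r sigma_al_loop' // coef_theta
        adjC e1 mulr1.
    by rewrite (coef_nabla2 g0 p t1 t2) /= eD' //; ring.
  have t2 : coef (sigma N c (tens (al' t.+2)
    (slice_r (sigma N c (tens (al t.+2) theta)) t.+1 t))) (t.+3, t.+2, t.+1) = 0.
    by rewrite sigma_al'_down // coef_slice_r sigma_al_down mulr0.
  by rewrite (coef_nabla2 g0 p t1 t2) g0 ?(mulr0, addr0, subr0) //; lia.
- case: x ex p p1 => // x ex p p1.
  case/and3P: p1 => _ _ /orP[/eqP et|/eqP[et]]; subst t.
    have t1 : coef (sigma N c (tens (al x.+1)
      (slice_r (sigma N c (tens (al' x.+1) theta)) x.+1 x.+2))) (x.+1, x.+2, x.+1)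
      = tau x.+1 * tau' x.+1.
      by rewrite sigma_al_loop // coef_slice_r sigma_al'_loop' // coef_theta ex
        mulr1.
    have [e1|/negbTE e1] := boolP (E x).
      have t2 : coef (sigma N c (tens (al' x)
        (slice_r (sigma N c (tens (al x) theta)) x.+1 x.+2))) (x.+1, x.+2, x.+1)
        = (1 + tau' x) * sig x.
        by rewrite sigma_al'_loop // coef_slice_r sigma_al_up // coef_theta ex
          mulr1.
      by rewrite (coef_nabla2 g0 p t1 t2) eA //=; ring.
    (* No lower loop here: the value left open by [erefl] is multiplied by a metric coefficient that
       is 0 by default. *)
    rewrite (coef_nabla2 g0 p t1 erefl) eA //=.
    rewrite [coef g (x.+1, x, _)]coef_out ?is_path2_loop' ?e1 //.
    by rewrite mulr0 mul0r !addr0 [X in _ - X]mulrC subrr.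
  have e1 : E x by have /andP[_ /=] := p; rewrite adjC.
  have t1 : coef (sigma N c (tens (al x.+1)
    (slice_r (sigma N c (tens (al' x.+1) theta)) x.+1 x))) (x.+1, x.+2, x.+1)
    = tau x.+1 * sig' x.+1.
    by rewrite sigma_al_loop // coef_slice_r sigma_al'_down // coef_theta adjC
      e1 mulr1.
  have t2 : coef (sigma N c (tens (al' x)
    (slice_r (sigma N c (tens (al x) theta)) x.+1 x))) (x.+1, x.+2, x.+1)
    = (1 + tau' x) * tau x.
    by rewrite sigma_al'_loop // coef_slice_r sigma_al_loop // coef_theta adjC
      e1 mulr1.
  rewrite (coef_nabla2 g0 p t1 t2) (g0 x.+2) /=; last by lia.
  by rewrite sub0r -[RHS]oppr0 -(eB' x e1 ex); congr (- _); ring.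
- case/and3P: p1 => _ _ /orP[/eqP et|/eqP[et]]; subst t.
    have e1 : E x.+1 by have /andP[_ /=] := p.
    have t1 : coef (sigma N c (tens (al x.+1)
      (slice_r (sigma N c (tens (al' x.+1) theta)) x.+1 x.+2))) (x.+1, x, x.+1)
      = (1 + tau x.+1) * tau' x.+1.
      by rewrite sigma_al_loop' // coef_slice_r sigma_al'_loop' // coef_theta
        e1 mulr1.
    have t2 : coef (sigma N c (tens (al' x)
      (slice_r (sigma N c (tens (al x) theta)) x.+1 x.+2))) (x.+1, x, x.+1)
      = tau' x * sig x.
      by rewrite sigma_al'_loop' // coef_slice_r sigma_al_up // coef_theta e1 mulr1.
    rewrite (coef_nabla2 g0 p t1 t2) (g0 x) /=; last by lia.
    by rewrite sub0r -[RHS]oppr0 -(eB x ex e1); congr (- _); ring.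
  have t2 : coef (sigma N c (tens (al' x)
    (slice_r (sigma N c (tens (al x) theta)) x.+1 x))) (x.+1, x, x.+1)
    = tau' x * tau x.
    by rewrite sigma_al'_loop' // coef_slice_r sigma_al_loop // coef_theta adjC
      ex mulr1.
  have [e1|/negbTE e1] := boolP (E x.+1).
    have t1 : coef (sigma N c (tens (al x.+1)
      (slice_r (sigma N c (tens (al' x.+1) theta)) x.+1 x))) (x.+1, x, x.+1)
      = (1 + tau x.+1) * sig' x.+1.
      by rewrite sigma_al_loop' // coef_slice_r sigma_al'_down // coef_theta
        adjC ex mulr1.
    by rewrite (coef_nabla2 g0 p t1 t2) eA' //=; ring.
  (* The same at a last vertex, where the upper loop is absent. *)
  rewrite (coef_nabla2 g0 p erefl t2) eA' //=.
  rewrite [coef g (x.+1, x.+2, _)]coef_out ?is_path2_loop ?e1 //.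
  by rewrite mulr0 mul0r addr0 add0r [tau' x * _]mulrC [X in _ - X]mulrC subrr.
Qed.
End LeviCivita.

(** * Solutions of the metric compatibility equations *)

Lemma adj_pred N x : adj N x.+2 x.+3 -> adj N x.+1 x.+2.
Proof. by rewrite /adj /is_vertex; case: N => [n|]; lia. Qed.

Section Recurrence.
Context {C : numClosedFieldType} {N : option nat}.
Variables (c : coeffs C) (h p : nat -> C) (e : C).
Local Notation E x := (adj N x x.+1).
Local Notation t i := (c_tau c i).
Local Notation t' i := (c_tau' c i).
Local Notation s i := (c_sig c i).
Local Notation s' i := (c_sig' c i).

(** Denominators are cleared and the graph is arbitrary, so that this serves both A_n and the
    half-line. Only the families (i, i+1, i, i+1) and (i, i-1, i, i+1) use the recurrence for phi;
    the others follow from the remaining relations. *)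
Lemma metric_QLC_of_recurrence :
  e = 1 \/ e = -1 ->
  (forall x, E x -> [/\ h x != 0, p x != 0 & t x != 0]) ->
  (forall x, E x -> p x.+1 = p 1%N - (p x)^-1) ->
  (forall x, E x -> ~~ E x.+1 -> p x.+1 = 0) ->
  (forall x, E x -> t x * t' x = e * (p x - p x.+1)) ->
  (forall x, E x -> E x.+1 -> (1 + t x.+1) * (p x + e * t x) = p x.+1) ->
  (forall x, E x -> E x.+1 -> s x * (1 + t' x) * (h x * p x) = h x.+1 * p x.+1) ->
  (forall x, E x -> E x.+1 -> s' x.+1 * (h x.+1 * p x.+1)
    = h x * (p x + e * t x)) ->
  metric_QLC (metric N h p e) (nabla N c) (sigma N c).
Proof.
move=> e1 nz recp pN rect' rect recs recs'.
have ee : e * e = 1 by case: e1 => ->; ring.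
have en0 : e != 0 by apply: contra_eq_neq ee => ->; rewrite mul0r eq_sym oner_neq0.
have gc := @metric_central C N h p e.
split.
  apply: central_is_metric => // x y xy; have := xy; case/and3P: xy => _ _.
  case/orP=> /eqP-> exy.
    by have [? ? _] := nz _ exy; rewrite coef_metric_loop // mulf_neq0.
  move: exy; rewrite adjC => /[dup] exy /nz[? _ _].
  by rewrite coef_metric_loop' // mulf_neq0.
split; [exact: nabla_bimodule_connection | exact: nabla_torsion_free | ].
(* Subtracting consecutive instances eliminates the initial value [p 1]. *)
have step x : E x -> E x.+1 -> p x.+2 = p x.+1 + (p x)^-1 - (p x.+1)^-1.
  by move=> ex ex'; rewrite (recp x.+1) // (recp x ex); ring.
apply: nabla2_eq0 => // x ex.
- rewrite coef_metric_loop // coef_metric_loop' // rect' //.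
  have [hn pn _] := nz _ ex.
  (* Vertex 1 has no lower loop, and the equation becomes phi_1 (phi_1 - phi_2) = 1. *)
  case: x ex hn pn => [|x] ex hn pn.
    rewrite [coef _ (1%N, _, _)]coef_out ?is_path2_loop' // (recp 1%N) //.
    rewrite mulr0 addr0; move: (p 1%N) (h 1%N) hn pn => P H hn pn.
    by field.
  have ex' := adj_pred ex; have [hn' pn' _] := nz _ ex'.
  rewrite coef_metric_loop' // (step _ ex' ex).
  rewrite [(1 + _) * s _]mulrC.
  have /(canRL (mulfK _)) -> := recs _ ex' ex; last by rewrite mulf_neq0.
  by field; rewrite hn' pn' pn.
- rewrite coef_metric_loop // coef_metric_loop' // rect' //.
  have [ex'|/[dup] ex' /negbTE nex'] := boolP (E x.+1); last first.
    (* At a last vertex there is no upper loop, and the end value 0 of [p] gives tau tau' = eps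
       phi. *)
    rewrite [coef _ (x.+1, _, _)]coef_out ?is_path2_loop ?nex' // pN //.
    by rewrite mulr0 addr0 subr0 mulrCA !mulrA ee; ring.
  rewrite coef_metric_loop // -[(1 + _) * _ * _]mulrA recs' //.
  rewrite [(1 + _) * _]mulrCA rect //.
  by case: e1 => ->; ring.
- move=> ex'; rewrite coef_metric_loop // coef_metric_loop' //.
  have [hn pn un] := nz _ ex; have [hn' pn' tn] := nz _ ex'.
  have R1 := rect _ ex ex'; have R2 := recs _ ex ex'.
  have R3 := rect' _ ex; have R4 := rect' _ ex'.
  have pq : p x + e * t x != 0.
    by apply: contraNneq pn' => q0; rewrite -R1 q0 mulr0.
  have u1 : 1 + t' x != 0.
    apply: contraNneq (mulf_neq0 hn' pn') => q0.
    by rewrite -R2 q0 mulr0 mul0r.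
  have Eu : t' x = e * (p x - p x.+1) / t x by rewrite -R3 mulrC mulKf.
  have Et' : t' x.+1 = e * (p x.+1 - p x.+2) / t x.+1 by rewrite -R4 mulrC mulKf.
  have Et : t x.+1 = p x.+1 / (p x + e * t x) - 1.
    by rewrite -R1 mulfK //; ring.
  have Es : s x = h x.+1 * p x.+1 / (h x * p x * (1 + t' x)).
    by rewrite -R2 [_ * (h x * _)]mulrAC -mulrA mulfK // mulf_neq0 // mulf_neq0.
  (* [d1] and [d2] concern tau_{x+1} (phi_x + eps tau_x) and tau_x (1 + tau_x'), the denominators
     that remain after substitution. *)
  have d1 : p x.+1 - (p x + e * t x) != 0.
    apply: contraNneq tn => d0.
    by rewrite Et (subr0_eq d0) divff ?subrr.
  have d2 : t x + e * (p x - p x.+1) != 0.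
    apply: contraNneq u1 => d0; rewrite Eu.
    have -> : 1 + e * (p x - p x.+1) / t x
      = (t x + e * (p x - p x.+1)) / t x by field.
    by rewrite d0 mul0r.
  rewrite Et' Es Eu Et (step _ ex ex').
  move: (p x) (p x.+1) (t x) (h x) (h x.+1) pn pn' un hn hn' pq d1 d2.
  move=> P P' T H H' pn0 pn1 un0 hn0 hn1.
  by case: e1 => ->; rewrite ?mul1r ?mulN1r => pq0 d10 d20;
    field; rewrite ?mul1r ?mulN1r ?pq0 ?d10 ?d20 ?pn0 ?pn1 ?un0 ?hn0 ?hn1.
- move=> ex'; rewrite coef_metric_loop // coef_metric_loop' //.
  rewrite -[t x.+1 * _ * _]mulrA recs' //.
  have -> : (1 + t' x) * t x * (e * h x) = h x * (e * (t x + t x * t' x)) by ring.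
  have -> : t x.+1 * (h x * (p x + e * t x))
    = h x * ((1 + t x.+1) * (p x + e * t x) - (p x + e * t x)) by ring.
  by rewrite rect // rect' //; case: e1 => ->; ring.
- by move=> ex'; rewrite !coef_metric_loop // recs.
- move=> ex'; rewrite !coef_metric_loop' //.
  have [hn' pn' tn] := nz _ ex'.
  have R1 := rect _ ex ex'; have R2 := recs' _ ex ex'.
  have pq : p x + e * t x != 0.
    by apply: contraNneq pn' => q0; rewrite -R1 q0 mulr0.
  apply: (mulIf (mulf_neq0 pn' pq)).
  have -> : s' x.+1 * (1 + t x.+1) * (e * h x.+1) * (p x.+1 * (p x + e * t x))
    = e * (s' x.+1 * (h x.+1 * p x.+1)) * ((1 + t x.+1) * (p x + e * t x)) by ring.
  by rewrite R1 R2; ring.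
Qed.
End Recurrence.

(** * Compatibility with the star structure *)

Section Star.
Context {C : numClosedFieldType} {N : option nat}.
Variable c : coeffs C.
Local Notation E x := (adj N x x.+1).
Local Notation theta := (@theta C N).
Local Notation t i := (c_tau c i).
Local Notation t' i := (c_tau' c i).
Local Notation s i := (c_sig c i).
Local Notation s' i := (c_sig' c i).

Lemma coef_star (w : Omega1 C N) x y : coef (star w) (x, y) = - (coef w (y, x))^*.
Proof.
rewrite coef_restr; case: ifP => // /negbT p.
by rewrite (@coef_out _ _ _ w) ?conjC0 ?oppr0 // /is_arrow adjC.
Qed.

Lemma coef_dagger (T : Tens2 C N) x y z :
  coef (dagger T) (x, y, z) = (coef T (z, y, x))^*.
Proof.
rewrite coef_restr; case: ifP => // /negbT p.
rewrite (@coef_out _ _ _ T) ?conjC0 //.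
by rewrite /is_path2 /= adjC [adj N y x]adjC andbC.
Qed.

(** Since [star] sends theta to -theta, the terms in [star w] (x) theta cancel between the two sides
    of the condition. *)
Lemma star_preservingE :
  star_preserving (nabla N c) (sigma N c) <->
  forall w : Omega1 C N,
    sigma N c (dagger (sigma N c (tens w theta))) = dagger (tens w theta).
Proof.
have eqw (w : Omega1 C N) :
    sigma N c (dagger (nabla N c w)) - nabla N c (star w)
    = dagger (tens w theta) - sigma N c (dagger (sigma N c (tens w theta))).
  have -> : dagger (nabla N c w)
      = - tens (star w) theta - dagger (sigma N c (tens w theta)).
    apply: coef_inj => -[[x y] z] _.
    rewrite coef_sub coef_opp !coef_dagger coef_sub !coef_tens coef_star
      rmorphB rmorphM /=.
    by rewrite !coef_theta (adjC _ z y) conjC_nat; ring.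
  have -> : nabla N c (star w)
      = - dagger (tens w theta) - sigma N c (tens (star w) theta).
    congr (_ - _); apply: coef_inj => -[[x y] z] _.
    rewrite coef_opp coef_dagger !coef_tens coef_star rmorphM /=.
    by rewrite !coef_theta (adjC _ y x) conjC_nat; ring.
  by rewrite sigmaD !sigmaN opprD !opprK addrACA [X in _ + X]addrC addrACA
    addNr add0r addrC.
split=> [sp w|sp w].
  by apply/esym/subr0_eq; rewrite -eqw sp subrr.
by apply/esym/subr0_eq; rewrite eqw sp subrr.
Qed.

(** [dagger] exchanges rising and falling paths and conjugates the coefficients of loops. The last
    four equations are the entries of M conj(M) = 1 for the block M at the vertex [x.+1]; at the
    ends of the graph the block is 1x1. *)
Lemma star_preserving_of_unitary :
  (forall x, E x -> E x.+1 ->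
    [/\ s x * (s' x.+1)^* = 1,
        t x.+1 * (t x.+1)^* + (1 + t' x) * (1 + t x.+1)^* = 1,
        t x.+1 * (1 + t' x)^* + (1 + t' x) * (t' x)^* = 0,
        t' x * (t' x)^* + (1 + t x.+1) * (1 + t' x)^* = 1
      & t' x * (1 + t x.+1)^* + (1 + t x.+1) * (t x.+1)^* = 0]) ->
  (forall x, E x.+1 -> ~~ E x -> t x.+1 * (t x.+1)^* = 1) ->
  (forall x, E x -> ~~ E x.+1 -> t' x * (t' x)^* = 1) ->
  star_preserving (nabla N c) (sigma N c).
Proof.
move=> int bdl bdr; apply/star_preservingE => w; move: (tens w theta) => T.
apply: coef_inj => -[[x y] z] p; rewrite coef_dagger; have := p; move: p.
elim/path2_ind => {x y z} [x|x|x ex|x ex] p.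
- have /andP[/= e1 e2] := p; have [ss _ _ _ _] := int _ e1 e2.
  by rewrite sigma_up coef_dagger sigma_down rmorphM /= mulrA ss mul1r.
- have /andP[/= ] := p; rewrite adjC => e2; rewrite adjC => e1.
  have [ss _ _ _ _] := int _ e1 e2.
  rewrite sigma_down coef_dagger sigma_up rmorphM /= mulrA.
  have -> : s' x.+1 * (s x)^*
    = (s x * (s' x.+1)^* )^* by rewrite rmorphM /= conjCK mulrC.
  by rewrite ss conjC1 mul1r.
- case: x ex {p} => // x ex.
  rewrite sigma_loop // !coef_dagger sigma_loop //=.
  have [e1|e1] := boolP (E x).
    have [_ m1 m2 _ _] := int _ e1 ex.
    rewrite sigma_loop' // !rmorphD !rmorphM /=.
    move: (coef T (x.+1, x.+2, x.+1))^* (coef T (x.+1, x, x.+1))^* => A B.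
    transitivity ((t x.+1 * (t x.+1)^* + (1 + t' x) * (1 + t x.+1)^* ) * A
      + (t x.+1 * (1 + t' x)^* + (1 + t' x) * (t' x)^* ) * B); first by ring.
    by rewrite m1 m2; ring.
  have o (S : Tens2 C N) : coef S (x.+1, x, x.+1) = 0.
    by rewrite coef_out // is_path2_loop'.
  by rewrite !o conjC0 !mulr0 !addr0 rmorphM mulrA bdl // mul1r.
- rewrite sigma_loop' // !coef_dagger sigma_loop' //=.
  have [e1|e1] := boolP (E x.+1).
    have [_ _ _ m1 m2] := int _ ex e1.
    rewrite sigma_loop //= !rmorphD !rmorphM /=.
    move: (coef T (x.+1, x, x.+1))^* (coef T (x.+1, x.+2, x.+1))^* => A B.
    transitivity ((t' x * (t' x)^* + (1 + t x.+1) * (1 + t' x)^* ) * A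
      + (t' x * (1 + t x.+1)^* + (1 + t x.+1) * (t x.+1)^* ) * B); first by ring.
    by rewrite m1 m2; ring.
  have o (S : Tens2 C N) : coef S (x.+1, x.+2, x.+1) = 0.
    by rewrite coef_out // is_path2_loop.
  by rewrite !o conjC0 !mulr0 !addr0 rmorphM mulrA bdr // mul1r.
Qed.

(** Tested on a_1 at the only loop based at vertex 1, where [sigma] is multiplication by tau_1. *)
Lemma star_preserving_norm_tau1 : E 1 ->
  star_preserving (nabla N c) (sigma N c) -> `|t 1%N| = 1.
Proof.
move=> e1 /star_preservingE /(_ (@a_ C N 1)) /(congr1 (fun T => coef T (1, 2,
  1)%N)).
rewrite sigma_loop // !coef_dagger coef_tens coef_al // coef_theta adjC e1 mulr1.
rewrite [coef (sigma _ _ _) (1, 0, 1)%N]coef_out ?is_path2_loop' //.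
rewrite sigma_al_loop // coef_theta adjC e1 mulr1 conjC0 mulr0 addr0 conjC1.
by rewrite -normCK => /eqP; rewrite sqrp_eq1 // => /eqP.
Qed.

End Star.

(** Here u and ub stand for tau_i and its conjugate, p and q for phi_i and phi_{i+1}, v and u' for
    tau_{i+1} and tau_i'. Treating u and ub as independent makes M conj(M) = 1 a set of rational
    identities. *)
Lemma unitary_loop_block {F : fieldType} (e p q u ub : F) :
  e = 1 \/ e = -1 -> p != 0 -> u * ub = p * (p - q) ->
  p + e * u != 0 -> p + e * ub != 0 ->
  let v := -1 + q / (p + e * u) in let vb := -1 + q / (p + e * ub) in
  let u' := e * ub / p in let ub' := e * u / p in
  [/\ v * vb + (1 + u') * (1 + vb) = 1, v * (1 + ub') + (1 + u') * ub' = 0,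
      u' * ub' + (1 + v) * (1 + ub') = 1 & u' * (1 + vb) + (1 + v) * vb = 0].
Proof.
move=> e1 p0 uub d1 d2 /=.
have -> : q = p - u * ub / p by rewrite uub; field.
by split; case: e1 d1 d2 => ->; rewrite ?mul1r ?mulN1r => d1 d2;
  field; rewrite ?mul1r ?mulN1r d1 ?d2 p0.
Qed.

Lemma adj_Some n x : adj (Some n) x x.+1 = (0 < x < n)%N.
Proof. by rewrite /adj /is_vertex; lia. Qed.

(** * The solution on A_n *)

Section Solution.
Context {C : numClosedFieldType}.
Implicit Types (h : nat -> C) (e psi tz : C).

Local Arguments phi : simpl never.
Local Arguments tau : simpl never.

Lemma phiS psi i : (0 < i)%N -> phi psi i.+1 = psi - (phi psi i)^-1.
Proof. by case: i. Qed.

Lemma phiSS psi i : (0 < i)%N ->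
  phi psi i.+2 = phi psi i.+1 + (phi psi i)^-1 - (phi psi i.+1)^-1.
Proof. by move=> i0; rewrite !phiS //; ring. Qed.

Lemma conj_tau_step (e P Q u : C) : e^* = e -> P^* = P -> Q^* = Q ->
  (-1 + Q / (P + e * u))^* = -1 + Q / (P + e * u^* ).
Proof.
move=> eC PC QC.
by rewrite rmorphD rmorphN fmorph_div !rmorphD rmorphM /= conjC1 eC PC QC.
Qed.

Lemma tauS e psi tz i : (0 < i)%N ->
  tau e psi tz i.+1 = -1 + phi psi i.+1 / (phi psi i + e * tau e psi tz i).
Proof. by case: i. Qed.

(** Read backwards, the recurrence is 1/phi_{n-i-1} = phi_1 - phi_{n-i}, and phi_n = 0 starts it at
    phi_1; so the reciprocals retrace the sequence. *)
Lemma phi_rev psi n i : admissible n psi -> (1 <= i < n)%N ->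
  phi psi (n - i) = 1 / phi psi i.
Proof.
move=> [pn p0]; elim: i => // i IH iN; rewrite div1r.
have n1 : (0 < n - i.+1)%N by lia.
have pS := phiS psi n1; rewrite -subSn ?subSS in pS; last by lia.
have q0 : phi psi (n - i.+1) != 0 by apply: p0; lia.
apply: invr_inj; rewrite invrK.
have -> : (phi psi (n - i.+1))^-1 = psi - phi psi (n - i) by rewrite pS; ring.
case: i IH iN {pS q0 n1} => [|i] IH iN; first by rewrite subn0 pn subr0.
by rewrite IH ?div1r; [rewrite (@phiS psi i.+1) | lia].
Qed.

Lemma solution_metric_QLC n h e psi tz :
  (forall i, (1 <= i < n)%N -> h i != 0) -> e = 1 \/ e = -1 ->
  admissible n psi -> solution_defined n e psi tz ->
  let c := solution h e psi tz in
  metric_QLC (metric (Some n) h (phi psi) e) (nabla (Some n) c) (sigma (Some n) c).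
Proof.
move=> h0 e1 [pn p0] [t0 d1 d2] c.
apply: metric_QLC_of_recurrence => // x; rewrite !adj_Some => xn.
- by split; [exact: h0 | exact: p0 | exact: t0].
- by rewrite phiS //; lia.
- by move=> xn'; have -> : x.+1 = n by lia.
- by rewrite /= mulrC divfK // t0.
- move=> xn'; have x0 : (0 < x)%N by lia.
  by rewrite [c_tau c x.+1](tauS _ _ _ x0) addrA subrr add0r divfK // d1 //; lia.
- move=> xn'; have d2x : 1 + c_tau' c x != 0 by apply: d2; lia.
  have hx := h0 _ xn; have px := p0 _ xn.
  have -> : c_sig c x = h x.+1 * phi psi x.+1 / (h x * phi psi x * (1 + c_tau'
    c x)) by [].
  by field; rewrite d2x px hx.
- move=> xn'; have hx := h0 _ xn'; have px := p0 _ xn'.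
  by rewrite /c /c_sig' /solution divfK // mulf_neq0.
Qed.

Lemma phi_real psi i : psi \is Num.real -> phi psi i \is Num.real.
Proof.
move=> pr; elim: i => [|[|i] IH] //; first exact: real0.
by rewrite phiS // rpredB // rpredV.
Qed.

(** * Initial values of norm 1 *)

Section UnitNorm.
Variables (n : nat) (e psi tz : C).
Hypotheses (e1 : e = 1 \/ e = -1) (psi_adm : admissible n psi).
Hypotheses (psi_real : psi \is Num.real) (tz_norm : `|tz| = 1).
Local Notation p := (phi psi).
Local Notation t := (tau e psi tz).

Lemma conj_e : e^* = e.
Proof. by case: e1 => ->; rewrite ?rmorphN /= conjC1. Qed.

Lemma conj_p i : (p i)^* = p i.
Proof. exact/conj_Creal/phi_real. Qed.

Lemma ee1 : e * e = 1.
Proof. by case: e1 => ->; ring. Qed.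

Lemma p_neq0 i : (0 < i < n)%N -> p i != 0.
Proof. exact: psi_adm.2. Qed.

(** Vanishing would give |tau_i|^2 = phi_i^2, which the norm law turns into phi_{i+1} = 0. *)
Lemma phi_tau_neq0 i : (i.+1 < n)%N -> (0 < i)%N ->
  t i * (t i)^* = p i * (p i - p i.+1) -> p i + e * t i != 0.
Proof.
move=> iN i0 tt.
have pi0 : p i != 0 by apply: p_neq0; lia.
have pi1 : p i.+1 != 0 by apply: p_neq0; lia.
apply: contraNneq pi1 => /eqP; rewrite addr_eq0 => /eqP pe.
have te : t i = - (e * p i) by rewrite pe mulrN opprK mulrA ee1 mul1r.
move: tt; rewrite te !rmorphN rmorphM /= conj_e conj_p mulrNN.
rewrite mulrACA ee1 mul1r => /(mulfI pi0) /eqP.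
by rewrite -[X in X == _]subr0 (inj_eq (addrI _)) eqr_opp eq_sym.
Qed.

(** The inequality is carried through the induction because with the norm law it makes tau_i
    nonzero; the base case is phi_1 (phi_1 - phi_2) = 1. *)
Lemma tau_normsq i : (0 < i < n)%N ->
  t i * (t i)^* = p i * (p i - p i.+1) /\ p i != p i.+1.
Proof.
elim: i => // -[|i] IH iN.
  have p10 : psi != 0 by apply: (@p_neq0 1%N).
  rewrite -normCK tz_norm (@phiS psi 1%N) // -[p 1%N]/psi; split; first by field.
  rewrite -subr_eq0 opprB addrCA subrr addr0 invr_eq0; exact: p10.
have [|tt pp] := IH; first by lia.
have d0 : p i.+1 + e * t i.+1 != 0 by apply: phi_tau_neq0; last exact: tt; lia.
have d0' : p i.+1 + e * (t i.+1)^* != 0.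
  by rewrite -conj_p -{1}conj_e -rmorphM -rmorphD conjC_eq0.
have p1 : p i.+1 != 0 by apply: p_neq0; lia.
have p2 : p i.+2 != 0 by apply: p_neq0; lia.
(* Expresses the new norm by the old pair, and transports the inequality as well. *)
have dp : p i.+2 * (p i.+2 - p i.+3) = (p i.+1 - p i.+2) / p i.+1.
  by rewrite (@phiSS psi i.+1) //; field; rewrite p1 p2.
split; last first.
  apply/eqP => p23; move: dp; rewrite -p23 subrr mulr0 => /esym/eqP.
  by rewrite mulf_eq0 invr_eq0 (negPf p1) orbF subr_eq0 (negPf pp).
rewrite dp tauS // conj_tau_step ?conj_e ?conj_p //.
(* Eliminating this phi leaves a rational identity in tau, its conjugate and one phi. *)
have q2 : p i.+2 = p i.+1 - t i.+1 * (t i.+1)^* / p i.+1 by rewrite tt; field.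
move: (t i.+1) (t i.+1)^* d0 d0' q2 => u ub;
  move: (p i.+1) (p i.+2) p1 => P Q P0 d0 d0' ->.
by case: e1 d0 d0' => ->; rewrite ?mul1r ?mulN1r => d0 d0';
  field; rewrite ?mul1r ?mulN1r d0 ?d0' P0.
Qed.

Lemma tau_neq0 i : (0 < i < n)%N -> t i != 0.
Proof.
move=> iN; have [tt pp] := tau_normsq iN; apply: contraNneq pp => t0.
by move/eqP: tt; rewrite t0 mul0r eq_sym mulf_eq0 (negPf (p_neq0 iN)) /= subr_eq0.
Qed.

Lemma solution_defined_of_norm1 : solution_defined n e psi tz.
Proof.
split=> i i0; first exact: tau_neq0.
  by move=> iN; apply: phi_tau_neq0 => //; apply: (tau_normsq _).1; lia.
move=> iN; have i0n : (0 < i < n)%N by lia.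
have [tt pp] := tau_normsq i0n; have t0 := tau_neq0 i0n.
have p2 : p i.+1 != 0 by apply: p_neq0; lia.
(* A zero denominator gives tau_i = -eps (phi_i - phi_{i+1}); comparing norms then gives phi_{i+1} =
   0. *)
apply: contraNneq p2 => d0.
have te : t i = - (e * (p i - p i.+1)).
  by apply/eqP; rewrite -addr_eq0 -[X in X + _]mulr1 -[X in _ + X](divfK t0)
    mulrC -mulrDl d0 mul0r.
move: tt; rewrite te !rmorphN rmorphM rmorphB /= conj_e !conj_p mulrNN mulrACA
  ee1 mul1r.
have dp : p i - p i.+1 != 0 by rewrite subr_eq0.
by move/(mulIf dp)/eqP; rewrite -[X in _ == X]subr0 (inj_eq (addrI _)) eqr_opp.
Qed.

Lemma solution_star_preserving h :
  (forall i, (0 < i < n)%N -> h i != 0) ->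
  (forall i, (0 < i < n)%N -> h i \is Num.real) ->
  let c := solution h e psi tz in
  star_preserving (nabla (Some n) c) (sigma (Some n) c).
Proof.
move=> h0 hr c; have [t0 d1 d2] := solution_defined_of_norm1.
(* The norm law trades phi_i - phi_{i+1} for the conjugate of tau_i, the form that
   [unitary_loop_block] expects. *)
have t'E i : (0 < i < n)%N -> c_tau' c i = e * (t i)^* / p i.
  move=> iN; have [tt _] := tau_normsq iN; have pn0 := p_neq0 iN; have tn0
    := tau_neq0 iN.
  rewrite /c /=; have -> : (p i - p i.+1) = t i * (t i)^* / p i by rewrite tt;
    field.
  by field; rewrite tn0 pn0.
have t'C i : (0 < i < n)%N -> (c_tau' c i)^* = e * t i / p i.
  by move=> iN; rewrite t'E // fmorph_div rmorphM /= conjCK conj_e conj_p.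
apply: star_preserving_of_unitary => x; rewrite !adj_Some => xn.
- move=> xn'; have [tt pp] := tau_normsq xn.
  have pn0 := p_neq0 xn; have pn1 := p_neq0 xn'.
  have q0 : p x + e * t x != 0 by apply: d1; lia.
  have q0' : p x + e * (t x)^* != 0.
    by rewrite -conj_p -{1}conj_e -rmorphM -rmorphD conjC_eq0.
  have [m1 m2 m3 m4] := unitary_loop_block e1 pn0 tt q0 q0'.
  have tS : c_tau c x.+1 = -1 + p x.+1 / (p x + e * t x) by rewrite -tauS //; lia.
  have tSC : (c_tau c x.+1)^* = -1 + p x.+1 / (p x + e * (t x)^* ).
    by rewrite tS conj_tau_step ?conj_e ?conj_p.
  have hx := h0 _ xn; have hx' := h0 _ xn'.
  have sE : c_sig c x = h x.+1 * p x.+1 / (h x * p x * (1 + c_tau' c x)) by [].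
  have s'E : c_sig' c x.+1 = h x * (p x + e * t x) / (h x.+1 * p x.+1) by [].
  have conj1D (z : C) : (1 + z)^* = 1 + z^* by rewrite rmorphD /= conjC1.
  rewrite !conj1D tSC t'C // sE t'E // tS; split=> //.
  rewrite s'E fmorph_div !rmorphM rmorphD rmorphM /= conj_e !conj_p.
  rewrite !(conj_Creal (hr _ _)) //.
  by field; rewrite hx hx' q0' pn0 pn1.
- move=> x0; have -> : x = 0%N by lia.
  by rewrite /= -normCK tz_norm expr1n.
- move=> xn'; rewrite t'E // -{2}t'E // t'C //.
  have xn1 : x.+1 = n by lia.
  have [tt _] := tau_normsq xn; have pn0 := p_neq0 xn.
  (* phi_n = 0 gives |tau_{n-1}|^2 = phi_{n-1}^2, so tau_{n-1}' has norm 1. *)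
  rewrite xn1 psi_adm.1 subr0 in tt.
  transitivity ((e * e) * (t x * (t x)^* ) / (p x * p x)); first by field.
  by rewrite tt ee1 mul1r divff // mulf_neq0.
Qed.
End UnitNorm.
End Solution.

(** * Chebyshev recurrence and q-integers *)

Section Chebyshev.
Context {C : numClosedFieldType}.
Variables (psi : C) (S : nat -> C) (m : nat).
Hypotheses (S0 : S 0%N = 0) (S1 : S 1%N = 1).
Hypothesis SS : forall i, S i.+2 = psi * S i.+1 - S i.
Hypothesis Sn0 : forall i, (0 < i <= m)%N -> S i != 0.
Local Notation p := (phi psi).
Local Arguments phi : simpl never.
Local Arguments tau : simpl never.

(** A discrete Wronskian: the recurrence has determinant 1, so the value at i = 0 persists. *)
Lemma chebyshev_cassini i : S i.+1 * S i.+1 - S i.+2 * S i = 1.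
Proof.
elim: i => [|i IH]; first by rewrite S0 S1; ring.
by rewrite -IH [S i.+3]SS; rewrite SS; ring.
Qed.

Lemma phi_chebyshev i : (0 < i <= m)%N -> p i = S i.+1 / S i.
Proof.
elim: i => // -[|i] IH im; first by rewrite SS S1 S0 -[p 1%N]/psi; field.
have Si1 : S i.+1 != 0 by apply: Sn0; lia.
have Si2 : S i.+2 != 0 by apply: Sn0; lia.
by rewrite phiS // IH ?[S i.+3]SS; [field; rewrite Si1 Si2 | lia].
Qed.

Variable s : C.
Hypothesis s1 : s = 1 \/ s = -1.
Local Notation t := (tau 1 psi s).
Local Notation T i := (s * (-1) ^+ i.-1 / S i).

Lemma signed_unit i : s * (-1) ^+ i = 1 \/ s * (-1) ^+ i = -1.
Proof.
elim: i => [|i]; first by rewrite expr0 mulr1.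
by rewrite exprS mulrCA mulN1r; case=> ->; [right | left; rewrite opprK].
Qed.

Lemma signedS i : s * (-1) ^+ i.+1 = - (s * (-1) ^+ i).
Proof. by rewrite exprS mulrCA mulN1r. Qed.

(** With u = s (-1)^i the two factors multiply to S_{i+2}^2 - 1 = S_{i+3} S_{i+1}. In closed form
    they are the numerators of phi_{i+1} + tau_{i+1} and 1 + tau_{i+2}, which occur as
    denominators. *)
Lemma chebyshev_pm1_neq0 i : (i.+3 <= m)%N -> 
  (S i.+2 + s * (-1) ^+ i != 0) /\ (S i.+2 - s * (-1) ^+ i != 0).
Proof.
move=> im.
have : (S i.+2 + s * (-1) ^+ i) * (S i.+2 - s * (-1) ^+ i) != 0.
  have -> : (S i.+2 + s * (-1) ^+ i) * (S i.+2 - s * (-1) ^+ i) = S i.+3 * S i.+1.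
    have -> : S i.+3 * S i.+1 = S i.+2 * S i.+2 - 1.
      by rewrite -(chebyshev_cassini i.+1); ring.
    by case: (signed_unit i) => ->; ring.
  by rewrite mulf_neq0 // Sn0 //; lia.
by rewrite mulf_eq0 negb_or => /andP.
Qed.

(** With u = s (-1)^i, the factorization of S_{i+2}^2 - 1 gives phi_{i+2} / (phi_{i+1} + tau_{i+1})
    = (S_{i+2} - u) / S_{i+2}. *)
Lemma tau_chebyshev i : (0 < i < m)%N -> t i = T i.
Proof.
elim: i => // -[|i] IH im; first by rewrite S1 expr0 mulr1 divr1.
have Si1 : S i.+1 != 0 by apply: Sn0; lia.
have Si2 : S i.+2 != 0 by apply: Sn0; lia.
have [|d1 d2] := @chebyshev_pm1_neq0 i; first by lia.
have im' : (0 < i.+1 < m)%N by lia.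
rewrite tauS // IH // !phi_chebyshev; [|lia|lia].
have -> : S i.+3 = (S i.+2 * S i.+2 - 1) / S i.+1.
  by rewrite -(chebyshev_cassini i.+1); field.
rewrite /= signedS; move: d1; case: (signed_unit i) => -> d1;
  by field; rewrite ?mul1r Si1 Si2 d1.
Qed.

(** By [chebyshev_cassini], phi_i - phi_{i+1} = 1 / (S_i S_{i+1}), which gives tau_i'; for sigma and
    sigma' the same identity lets one of the factors S + u, S - u cancel. *)
Lemma solution_chebyshev h :
  (forall i, (0 < i < m)%N -> h i != 0) ->
  let c := solution h 1 psi s in
  [/\ forall i, (0 < i < m)%N -> c_tau' c i = - T i.+1,
      forall i, (0 < i)%N -> (i.+1 < m)%N ->
        c_sig c i = h i.+1 / h i * (1 + T i.+1)
    & forall i, (1 < i < m)%N ->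
        c_sig' c i = h i.-1 / h i * (1 / (1 + T i))].
Proof.
move=> h0 c.
have t'E i : (0 < i < m)%N -> c_tau' c i = - T i.+1.
  case: i => // i im.
  have Si1 : S i.+1 != 0 by apply: Sn0; lia.
  have Si2 : S i.+2 != 0 by apply: Sn0; lia.
  have -> : c_tau' c i.+1 = 1 * (p i.+1 - p i.+2) / t i.+1 by [].
  rewrite tau_chebyshev // !phi_chebyshev; [|lia|lia].
  have -> : S i.+3 = (S i.+2 * S i.+2 - 1) / S i.+1.
    by rewrite -(chebyshev_cassini i.+1); field.
  rewrite /= signedS.
  by case: (signed_unit i) => ->; field; rewrite Si1 Si2.
split=> //.
  case=> // i _ im.
  have Si1 : S i.+1 != 0 by apply: Sn0; lia.
  have Si2 : S i.+2 != 0 by apply: Sn0; lia.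
  have h1 : h i.+1 != 0 by apply: h0; lia.
  have h2 : h i.+2 != 0 by apply: h0; lia.
  have [|d1 d2] := @chebyshev_pm1_neq0 i; first by lia.
  have -> : c_sig c i.+1
    = h i.+2 * p i.+2 / (h i.+1 * p i.+1 * (1 + c_tau' c i.+1)) by [].
  rewrite t'E; last by lia.
  rewrite !phi_chebyshev; [|lia|lia].
  have -> : S i.+3 = (S i.+2 * S i.+2 - 1) / S i.+1.
    by rewrite -(chebyshev_cassini i.+1); field.
  rewrite /= signedS; move: d1 d2.
  by case: (signed_unit i) => -> d1 d2; field; rewrite ?mul1r h1 Si1 Si2 d1 ?d2.
case=> // -[|i] // im.
have Si1 : S i.+1 != 0 by apply: Sn0; lia.
have Si2 : S i.+2 != 0 by apply: Sn0; lia.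
have Si3 : S i.+3 != 0 by apply: Sn0; lia.
have h1 : h i.+1 != 0 by apply: h0; lia.
have h2 : h i.+2 != 0 by apply: h0; lia.
have [|d1 d2] := @chebyshev_pm1_neq0 i; first by lia.
have -> : c_sig' c i.+2 = h i.+1 * (p i.+1 + 1 * t i.+1) / (h i.+2 * p i.+2) by [].
rewrite tau_chebyshev ?phi_chebyshev; [|lia|lia|lia].
have cas : S i.+3 = (S i.+2 * S i.+2 - 1) / S i.+1.
  by rewrite -(chebyshev_cassini i.+1); field.
(* The denominator S_{i+3} turns into the condition that S_{i+2}^2 - 1 is nonzero. *)
rewrite cas in Si3 *; move: Si3; rewrite mulf_eq0 invr_eq0 negb_or => /andP[Si3 _].
rewrite /= signedS; move: d1 d2.
by case: (signed_unit i) => -> d1; rewrite ?opprK => d2; field;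
  rewrite h2 Si1 Si2 Si3 d2.
Qed.
End Chebyshev.

(** * q-integers and their limit as q tends to 1 *)

Section QInt.
Context {C : numClosedFieldType}.

Lemma qint0 (q : C) : qint q 0 = 0.
Proof. by rewrite /qint expr0 invr1 subrr mul0r. Qed.

Lemma qint1 (q : C) : q - q^-1 != 0 -> qint q 1 = 1.
Proof. by move=> q1; rewrite /qint expr1 divff. Qed.

Lemma qintSS (q : C) i : qint q i.+2 = (q + q^-1) * qint q i.+1 - qint q i.
Proof.
(* At q = 0 the convention 0^-1 = 0 makes every q-integer 0. *)
have [->|q0] := eqVneq q 0; first by rewrite /qint invr0 subrr invr0 !mulr0 subrr.
rewrite /qint mulrA -mulrBl; congr (_ / _); rewrite !exprS.
have : q ^+ i != 0 by rewrite expf_neq0.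
by move: (q ^+ i) => a a0; field; rewrite a0 q0.
Qed.

Lemma qint_neq0_near1 : \forall q \near (1 : C^o)^', q - q^-1 != 0.
Proof.
have n2 : \forall q \near (1 : C^o)^', q + 1 != 0.
  apply: (@cvgr_neq0 _ _ _ _ _ (fun q : C^o => q + 1) (1 + 1 : C^o));
    last by rewrite -[1 + 1]/(2%:R : C) pnatr_eq0.
  by apply: cvgD; [exact: cvg_within | exact: cvg_cst].
have n0 : \forall q \near (1 : C^o)^', q != 0.
  apply: (@cvgr_neq0 _ _ _ _ _ (fun q : C^o => q) (1 : C^o));
    last by rewrite oner_neq0.
  exact: cvg_within.
near=> q.
have q1 : q != 1 by near: q; exact: nbhs_dnbhs_neq.
have q2 : q + 1 != 0 by near: q.
have q0 : q != 0 by near: q.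
have -> : q - q^-1 = (q - 1) * (q + 1) / q by field.
by rewrite !mulf_neq0 ?invr_eq0 ?subr_eq0.
Unshelve. all: by end_near. Qed.

(** The quotient is 0/0 at q = 1; the limit is taken in the recurrence [qintSS] instead, two
    consecutive indices at a time. *)
Lemma qint_cvg i : (qint q i : C^o) @[q --> (1 : C^o)^'] --> (i%:R : C^o).
Proof.
have c0 : (qint q 0 : C^o) @[q --> (1 : C^o)^'] --> (0%:R : C^o).
  by under eq_fun do rewrite qint0; exact: cvg_cst.
have c1 : (qint q 1 : C^o) @[q --> (1 : C^o)^'] --> (1%:R : C^o).
  apply: (@cvg_trans _ ((fun=> 1 : C^o) @ (1 : C^o)^')); last exact: cvg_cst.
  apply: near_eq_cvg; near=> q; rewrite qint1 //; near: q; exact: qint_neq0_near1.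
suff [] : (qint q i : C^o) @[q --> (1 : C^o)^'] --> (i%:R : C^o) /\
   (qint q i.+1 : C^o) @[q --> (1 : C^o)^'] --> (i.+1%:R : C^o) by [].
elim: i => [//|i [ci ci1]]; split=> //.
under eq_fun do rewrite qintSS.
have -> : (i.+2%:R : C^o) = (1 + 1^-1) * i.+1%:R - i%:R.
  by rewrite invr1 -!natr1; ring.
apply: cvgB => //; apply: cvgM => //; apply: cvgD; first exact: cvg_within.
by apply: cvgV; [rewrite oner_neq0 | exact: cvg_within].
Unshelve. all: by end_near. Qed.
End QInt.

(** * Uniqueness of the positive choice *)

Section Uniqueness.
Context {C : numClosedFieldType}.
Local Arguments phi : simpl never.

(** The map x -> -1/x is increasing on positive x, so the recurrence preserves the order; positivity
    up to n-1 carries it to n. *)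
Lemma phi_lt n (psi psi' : C) : psi < psi' ->
  (forall i, (1 <= i < n)%N -> 0 < phi psi i) ->
  (forall i, (1 <= i < n)%N -> 0 < phi psi' i) ->
  forall i, (1 <= i <= n)%N -> phi psi i < phi psi' i.
Proof.
move=> lt_psi pos pos'; elim=> // -[|i] IH iN //.
have q0 : 0 < phi psi i.+1 by apply: pos; lia.
have q0' : 0 < phi psi' i.+1 by apply: pos'; lia.
rewrite (@phiS _ psi i.+1) // (@phiS _ psi' i.+1) //.
apply: ltrD => //; rewrite ltrN2 ltf_pV2 ?posrE //.
by apply: IH; lia.
Qed.

(** Both sequences are 0 at n, against strict monotonicity. *)
Lemma admissible_pos_inj n (psi psi' : C) : (1 < n)%N ->
  admissible n psi -> (forall i, (1 <= i < n)%N -> 0 < phi psi i) ->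
  admissible n psi' -> (forall i, (1 <= i < n)%N -> 0 < phi psi' i) ->
  psi = psi'.
Proof.
move=> n1 [pn _] pos [pn' _] pos'.
(* A positive element of C is real, so the two initial values are comparable. *)
have psi0 : psi \is Num.real by apply: gtr0_real; apply: (pos 1%N); lia.
have psi0' : psi' \is Num.real by apply: gtr0_real; apply: (pos' 1%N); lia.
have nn : (1 <= n <= n)%N by lia.
case: (real_ltgtP psi0 psi0') => // lt_psi.
  by have := phi_lt lt_psi pos pos' nn; rewrite pn pn' ltxx.
by have := phi_lt lt_psi pos' pos nn; rewrite pn pn' ltxx.
Qed.
End Uniqueness.

(** * The half-line graph as the limit q = 1 *)

Section HalfLine.
Context {C : numClosedFieldType}.
Implicit Types h : nat -> C.

Lemma adj_None x : adj None x x.+1 = (0 < x)%N.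
Proof. by rewrite /adj /is_vertex !andbT eqxx /= andbT. Qed.

(** The same recurrences with S_i = i, that is, phi_1 = 2. *)
Lemma half_line_metric_QLC h (s : C) : s = 1 \/ s = -1 ->
  (forall i, (1 <= i)%N -> h i != 0) ->
  let c := coeffs_of_tau h (fun i => s * (-1) ^+ i.-1 / i%:R) in
  metric_QLC (metric None h (fun i => i.+1%:R / i%:R) 1)
             (nabla None c) (sigma None c).
Proof.
move=> s1 h0 c.
have n0 k : (k.+1%:R : C) != 0 by rewrite pnatr_eq0.
have st k : s * (-1) ^+ k.+1 = - (s * (-1) ^+ k) by rewrite exprS mulrCA mulN1r.
(* Numerals are written as k, k + 1, k + 1 + 1 with k generalized, so that [field] sees one variable
   for the index. *)
have E2 k : (k.+2%:R : C) = k.+1%:R + 1 by rewrite natr1.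
have d0 k : (k.+1%:R + 1 : C) != 0 by rewrite natr1.
have d1 k : (k.+1%:R + 1 + 1 : C) != 0 by rewrite !natr1.
apply: metric_QLC_of_recurrence; first by left.
- move=> [//|x] _; rewrite h0 // /= !mulf_neq0 ?invr_eq0 ?n0 //.
    by case: s1 => ->; rewrite ?oppr_eq0 oner_neq0.
  by rewrite expf_neq0 // oppr_eq0 oner_neq0.
- move=> [//|x] _; rewrite !(E2 x.+1) !E2; move: (n0 x) (d0 x);
    move: (x.+1%:R) => k k0 k1.
  by field; rewrite k0 k1.
- by move=> [//|x] _; rewrite adj_None.
- move=> [//|x] _; rewrite /= st !(E2 x.+1) !E2; move: (n0 x) (d0 x);
    move: (x.+1%:R) => k k0 k1.
  by case: (signed_unit s1 x) => ->; field; rewrite k0 k1.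
- move=> [//|x] _ _; rewrite /= st !(E2 x.+1) !E2; move: (n0 x) (d0 x) ;
    move: (x.+1%:R) => k k0 k1.
  by case: (signed_unit s1 x) => ->; field; rewrite k0 k1.
- move=> [//|x] _ _; have hx := h0 x.+1 isT; have hx' := h0 x.+2 isT.
  rewrite /= st !(E2 x.+1) !E2; move: (n0 x) (d0 x); move: (x.+1%:R) => k k0 k1.
  by case: (signed_unit s1 x) => ->; field; rewrite k0 k1 hx.
- move=> [//|x] _ _; have hx := h0 x.+1 isT; have hx' := h0 x.+2 isT.
  rewrite /= st !(E2 x.+1) !E2; move: (n0 x) (d0 x) (d1 x);
    move: (x.+1%:R) => k k0 k1 k2.
  by case: (signed_unit s1 x) => ->; field; rewrite ?k0 ?k1 ?k2 ?hx ?hx'.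
Qed.

Lemma qint_ratio_cvg i : (1 <= i)%N ->
  (qint q i.+1 / qint q i : C^o) @[q --> (1 : C^o)^']
    --> (i.+1%:R / i%:R : C^o).
Proof.
move=> i0; apply: cvgM; first exact: qint_cvg.
by apply: cvgV; [rewrite pnatr_eq0; lia | exact: qint_cvg].
Qed.

Lemma tau_q_cvg (s : C) i : (1 <= i)%N ->
  (tau_q q s i : C^o) @[q --> (1 : C^o)^']
    --> (s * (-1) ^+ i.-1 / i%:R : C^o).
Proof.
move=> i0; apply: cvgM; first exact: cvg_cst.
by apply: cvgV; [rewrite pnatr_eq0; lia | exact: qint_cvg].
Qed.
End HalfLine.

(** * q-integers at a point of the unit circle *)

Section Trigonometry.
Context {R : realType}.
Implicit Types x y : R.

Lemma cisD x y : cis (x + y) = cis x * cis y.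
Proof.
by apply/eqP; rewrite eq_complex /= cosD sinD addrC [X in _ && (_ == X)]addrC
  eqxx addrC eqxx.
Qed.

Lemma cis_inv x : (cis x)^-1 = cis (- x).
Proof.
have e : cis x * cis (- x) = 1.
  by rewrite -cisD subrr /cis cos0 sin0.
have c0 : cis x != 0 by apply: contra_eq_neq e => ->;
  rewrite mul0r eq_sym oner_neq0.
by apply: (mulfI c0); rewrite e divff.
Qed.

Lemma cisDV x : cis x + (cis x)^-1 = (2 * cos x)%:C%C.
Proof.
rewrite cis_inv; apply/eqP; rewrite eq_complex /= cosN sinN subrr eqxx andbT.
by apply/eqP; ring.
Qed.

Lemma cisBV_neq0 x : sin x != 0 -> cis x - (cis x)^-1 != 0.
Proof.
move=> s0; rewrite cis_inv eq_complex /= cosN sinN opprK negb_and orbC.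
by rewrite -mulr2n mulrn_eq0 /= s0.
Qed.

(** Both sides obey the recurrence with multiplier 2 cos x and agree at 0 and 1. *)
Lemma qint_cis x i : sin x != 0 -> qint (cis x) i = (sin (i%:R * x) / sin x)%:C%C.
Proof.
move=> s0.
suff [] : qint (cis x) i = (sin (i%:R * x) / sin x)%:C%C /\
   qint (cis x) i.+1 = (sin (i.+1%:R * x) / sin x)%:C%C by [].
elim: i => [|i [q0 q1]].
  by rewrite qint0 qint1 ?cisBV_neq0 // mul0r sin0 mul0r mul1r divff.
split=> //; rewrite qintSS q0 q1 cisDV -rmorphM -rmorphB; congr (_%:C%C).
(* Both outer angles are expanded about (i+1) x. *)
have -> : i.+2%:R * x = i.+1%:R * x + x by rewrite -[i.+2%:R]natr1; ring.
have -> : i%:R * x = i.+1%:R * x - x by rewrite -[i.+1%:R]natr1; ring.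
by rewrite sinB sinD; field.
Qed.

Lemma sin_mul_gt0 n i : (1 <= i <= n)%N -> 0 < sin (i%:R * (pi / n.+1%:R) : R).
Proof.
move=> iN; have n0 : (0 : R) < n.+1%:R by rewrite ltr0n.
apply: sin_gt0_pi; apply/andP; split.
  by rewrite mulr_gt0 ?divr_gt0 ?pi_gt0 // ltr0n; lia.
rewrite mulrA ltr_pdivrMr // mulrC ltr_pM2l ?pi_gt0 // ltr_nat; lia.
Qed.

Lemma sin_mul_end n : sin (n.+1%:R * (pi / n.+1%:R) : R) = 0.
Proof. by rewrite mulrC divfK ?sinpi // pnatr_eq0. Qed.
End Trigonometry.

(** * Assembly of the three claims and of the half-line limit *)

Theorem corollary4p4 (R : realType) (n : nat) (n_ge2 : (2 <= n)%N) :
  (forall (h : nat -> R[i]) (eps phi1 : R[i]),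
     (forall i, (1 <= i < n)%N -> h i != 0) ->
     eps = 1 \/ eps = -1 ->
     admissible n phi1 ->
     [/\ (forall tau1 : R[i], tau1 != 0 -> solution_defined n eps phi1 tau1 ->
            let c := solution h eps phi1 tau1 in
            metric_QLC (metric (Some n) h (phi phi1) eps)
                       (nabla (Some n) c) (sigma (Some n) c)),
         ((forall i, (1 <= i < n)%N -> h i \is Num.real) ->
          phi1 \is Num.real ->
          (forall tau1 : R[i], `|tau1| = 1 ->
             solution_defined n eps phi1 tau1) /\
          (forall tau1 : R[i], tau1 != 0 -> solution_defined n eps phi1 tau1 ->
             let c := solution h eps phi1 tau1 in
             star_preserving (nabla (Some n) c) (sigma (Some n) c)
             <-> `|tau1| = 1))
       & forall i, (1 <= i < n)%N -> phi phi1 (n - i) = 1 / phi phi1 i]) /\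
  let x : R := pi / n.+1%:R in
  let q : R[i] := cis x in
  let phi1 : R[i] := (2 * cos x)%:C%C in
  ((forall psi1 : R[i],
      admissible n psi1 /\ (forall i, (1 <= i < n)%N -> 0 < phi psi1 i)
      <-> psi1 = phi1) /\
   (forall i, (1 <= i < n)%N ->
      phi phi1 i = (sin (i.+1%:R * x) / sin (i%:R * x))%:C%C /\
      phi phi1 i = qint q i.+1 / qint q i)) /\
  (forall (h : nat -> R[i]) (s : R[i]),
     (forall i, (1 <= i < n)%N -> h i != 0) ->
     s = 1 \/ s = -1 ->
     let c := solution h 1 phi1 s in
     [/\ solution_defined n 1 phi1 s,
         metric_QLC (metric (Some n) h (phi phi1) 1)
                    (nabla (Some n) c) (sigma (Some n) c),
         (forall i, (1 <= i < n)%N -> c_tau c i = tau_q q s i)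
       & [/\ forall i, (1 <= i < n)%N -> c_tau' c i = - tau_q q s i.+1,
             forall i, (1 <= i)%N -> (i.+1 < n)%N ->
               c_sig c i = h i.+1 / h i * (1 + tau_q q s i.+1)
           & forall i, (2 <= i < n)%N ->
               c_sig' c i = h i.-1 / h i * (1 / (1 + tau_q q s i))]]) /\
  (forall s : R[i], s = 1 \/ s = -1 ->
     let phi_hl i : R[i] := i.+1%:R / i%:R in
     let tau_hl i : R[i] := s * (-1) ^+ i.-1 / i%:R in
     (forall h : nat -> R[i], (forall i, (1 <= i)%N -> h i != 0) ->
        let c := coeffs_of_tau h tau_hl in
        metric_QLC (metric None h phi_hl 1)
                   (nabla None c) (sigma None c)) /\
     (forall i, (1 <= i)%N ->
        (qint p i.+1 / qint p i : R[i]^o) @[p --> (1 : R[i]^o)^']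
          --> (phi_hl i : R[i]^o) /\
        (tau_q p s i : R[i]^o) @[p --> (1 : R[i]^o)^']
          --> (tau_hl i : R[i]^o))).
Proof.
split.
  move=> h eps phi1 h0 e1 adm; split.
  - by move=> tau1 _ def; exact: solution_metric_QLC.
  - move=> hr pr; split=> [tau1 t1|tau1 t0 def c].
      exact: solution_defined_of_norm1.
    split=> [|t1]; last exact: solution_star_preserving.
    by apply: star_preserving_norm_tau1; rewrite adj_Some.
  - by move=> i iN; exact: phi_rev.
move=> x q phi1.
have s0 : sin x != 0.
  have : 0 < sin (1%:R * x) by apply: sin_mul_gt0; rewrite (ltnW n_ge2).
  by rewrite mul1r => /lt0r_neq0.
have sin_gt i : (1 <= i <= n)%N -> 0 < sin (i%:R * x) by exact: sin_mul_gt0.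
have qE i : qint q i = (sin (i%:R * x) / sin x)%:C%C by exact: qint_cis.
have q0 : qint q 0 = 0 by exact: qint0.
have q1 : qint q 1 = 1 by apply/qint1/cisBV_neq0.
(* Since q + 1/q = 2 cos x, the q-integers form a sequence S as in the Chebyshev section. *)
have qS i : qint q i.+2 = phi1 * qint q i.+1 - qint q i by rewrite qintSS cisDV.
have qn0 i : (0 < i <= n)%N -> qint q i != 0.
  move=> iN; rewrite qE fmorph_eq0 mulf_neq0 ?invr_eq0 //.
  by apply: lt0r_neq0; exact: sin_gt.
have phi_q i : (1 <= i <= n)%N -> phi phi1 i = qint q i.+1 / qint q i.
  by apply: phi_chebyshev.
have phi_sin i : (1 <= i <= n)%N ->
    phi phi1 i = (sin (i.+1%:R * x) / sin (i%:R * x))%:C%C.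
  move=> iN; have := lt0r_neq0 (sin_gt _ iN) => si0.
  rewrite phi_q // !qE -fmorph_div; congr (_%:C%C).
  by field; rewrite s0 si0.
have phi_pos i : (1 <= i < n)%N -> 0 < phi phi1 i.
  by move=> iN; rewrite phi_sin ?ltcR ?divr_gt0 ?sin_gt //; lia.
have adm : admissible n phi1.
  split=> [|i iN]; last exact/lt0r_neq0/phi_pos.
  (* phi_n = 0 because (n+1) x = pi. *)
  by rewrite phi_sin ?sin_mul_end ?mul0r //; lia.
split.
  split=> [psi1|i iN].
    split=> [[adm1 pos1]|->]; last by [].
    exact: (admissible_pos_inj n_ge2).
  by split; [apply: phi_sin; lia | apply: phi_q; lia].
split; last first.
  move=> s s1 phi_hl tau_hl; split=> [h h0 c|i i0].
    exact: half_line_metric_QLC.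
  by split; [exact: qint_ratio_cvg | exact: tau_q_cvg].
move=> h s h0 s1 c.
have e1 : (1 : R[i]) = 1 \/ (1 : R[i]) = -1 by left.
have sn : `|s| = 1 by case: s1 => ->; rewrite ?normrN normr1.
have phi1_real : phi1 \is Num.real by rewrite complex_real.
(* The unit norm case applies, as |s| = 1 and phi_1 is real. *)
have def : solution_defined n 1 phi1 s by exact: solution_defined_of_norm1.
(* Here m = n: the q-integers are nonzero up to n, which covers the value of [tau_q] at n needed for
   tau_{n-1}'. *)
have [t' sg sg'] := solution_chebyshev q0 q1 qS qn0 s1 h0.
split=> //.
  exact: solution_metric_QLC.
by move=> i iN; exact: (tau_chebyshev q0 q1 qS qn0 s1).
Qed.
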